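(* Let $\phi$ be a pure state not in the output free set $\mathcal F'$, in a convex resource theory, and let $\rho$ be any input state. For any $\varepsilon$ satisfying $\varepsilon\ge\left(\frac{\Omega_{\mathcal F}(\rho)}{R^{\mathcal F'}_{\mathcal F'}(\phi)-1}+1\right)^{-1}$, there exists a resource--non-generating probabilistic transformation $\rho\to\tau_\varepsilon$ where $\tau_\varepsilon$ is a state with $F(\tau_\varepsilon,\phi)\ge1-\varepsilon$. If the resource theory is affine, the same conclusion holds for any $\varepsilon$ satisfying $\varepsilon\ge\left(\frac{\Omega_{\mathcal F}(\rho)}{R_{\mathcal F'}(\phi)-1}+1\right)^{-1}$.
   Context: Finite dimensions; $A\le B$ means $B-A\ge0$. Each space carries a closed convex set $\mathcal F$ of free density operators; ''affine'' means additionally $\mathcal F=\mathrm{aff}(\mathcal F)\cap\mathcal D$ on each space. $\mathrm{cone}(\mathcal F)=\{\lambda\sigma:\lambda\ge0,\sigma\in\mathcal F\}$, $A\le_{\mathcal F}B$ iff $B-A\in\mathrm{cone}(\mathcal F)$. $R_{\max}(X\|Y)=\inf\{\lambda:X\le\lambda Y\}$, $R^{\mathcal F}_{\max}(X\|Y)=\inf\{\lambda:X\le_{\mathcal F}\lambda Y\}$; conventions $\inf\emptyset=\infty$, $c/\infty=0$, $0^{-1}=\infty$, $\infty^{-1}=0$. $R_{\mathcal F}(\rho)=\min_{\sigma\in\mathcal F}R_{\max}(\rho\|\sigma)$, $R^{\mathcal F}_{\mathcal F}(\rho)=\min_{\sigma\in\mathcal F}R^{\mathcal F}_{\max}(\rho\|\sigma)$,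 $\Omega_{\mathcal F}(\rho)=\inf_{\sigma\in\mathcal F}R_{\max}(\rho\|\sigma)R_{\max}(\sigma\|\rho)$. Fidelity $F(\rho,\sigma)=\|\sqrt\rho\sqrt\sigma\|_1^2$. $\mathbb O$: completely positive trace-non-increasing maps $\mathcal E$ such that for every $\sigma\in\mathcal F$ there exist $\sigma'\in\mathcal F'$ and $p\in[0,1]$ with $\mathcal E(\sigma)=p\sigma'$. A probabilistic transformation $\rho\to\tau$ exists iff $\tau$ lies in the closure of $\{\mathcal E(\rho)/\mathrm{Tr}\,\mathcal E(\rho):\mathcal E\in\mathbb O,\ \mathrm{Tr}\,\mathcal E(\rho)>0\}$. *)

(* Defs.v *)
(* mathcomp + mathcomp-analysis (extended reals, classical
   choice) + mathcomp-real-closed (complex numbers R[i] over a realType R). *)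
From HB Require Import structures.
From mathcomp Require Import all_boot all_order all_algebra.
From mathcomp Require Import all_classical all_reals all_analysis.
From mathcomp Require Import complex.

Set Implicit Arguments.
Unset Strict Implicit.
Unset Printing Implicit Defensive.

Import Order.TTheory GRing.Theory Num.Theory.
Local Open Scope ring_scope.
Local Open Scope classical_set_scope.

Section QRT.
Variable R : realType.
Local Notation C := (R[i]).

(* real scalars embedded in C *)
Definition rC (x : R) : C := Complex x 0.

(* --- positivity --------------------------------------------------------- *)
(* positive semidefiniteness of an operator on C^I, I a finite index set:
   Hermitian with nonnegative quadratic form *)
Definition psdF (I : finType) (A : I -> I -> C) : Prop :=
  (forall i j, A j i = (A i j)^*) /\
  (forall v : I -> C, 0 <= \sum_i \sum_j ((v i)^* * A i j * v j)).

Definition psd (n : nat) (A : 'M[C]_n) : Prop := psdF (fun i j => A i j).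

(* Loewner order A <= B  iff  B - A >= 0 *)
Definition loewner (n : nat) (A B : 'M[C]_n) : Prop := psd (B - A).

Definition density (n : nat) (A : 'M[C]_n) : Prop := psd A /\ \tr A = 1.

(* pure state: rank-one density operator *)
Definition pure (n : nat) (A : 'M[C]_n) : Prop := density A /\ \rank A = 1%N.

(* --- closure w.r.t. the (entrywise, equivalently any norm) topology ----- *)
Definition in_closure (n : nat) (S : set 'M[C]_n) (X : 'M[C]_n) : Prop :=
  forall e : R, 0 < e -> exists2 Y, S Y & forall i j, `|Y i j - X i j| < rC e.

(* --- free sets ----------------------------------------------------------- *)
Definition convex_set (n : nat) (F : set 'M[C]_n) : Prop :=
  forall s1 s2 (t : R), F s1 -> F s2 -> 0 <= t <= 1 ->
    F (rC t *: s1 + rC (1 - t) *: s2).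

Definition closed_set (n : nat) (F : set 'M[C]_n) : Prop :=
  forall X, in_closure F X -> F X.

(* a closed convex (nonempty) set of free density operators *)
Definition free_set (n : nat) (F : set 'M[C]_n) : Prop :=
  [/\ forall s, F s -> density s, convex_set F, closed_set F & F !=set0].

(* affine: F = aff(F) \cap D  (the inclusion F \subseteq aff(F) \cap D being
   automatic, this says: every density operator that is a real affine
   combination of free states is free) *)
Definition affine_set (n : nat) (F : set 'M[C]_n) : Prop :=
  forall (k : nat) (c : 'I_k -> R) (s : 'I_k -> 'M[C]_n),
    (forall i, F (s i)) -> \sum_i c i = 1 ->
    density (\sum_i rC (c i) *: s i) -> F (\sum_i rC (c i) *: s i).

(* cone(F) and the induced order A <=_F B *)
Definition cone (n : nat) (F : set 'M[C]_n) (A : 'M[C]_n) : Prop :=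
  exists2 l : R, 0 <= l & exists2 s, F s & A = rC l *: s.

Definition le_cone (n : nat) (F : set 'M[C]_n) (A B : 'M[C]_n) : Prop :=
  cone F (B - A).

(* --- robustness-type quantities (extended reals, inf set0 = +oo) -------- *)
Definition Rmax (n : nat) (X Y : 'M[C]_n) : \bar R :=
  ereal_inf [set l%:E | l in [set l : R | loewner X (rC l *: Y)]].

Definition RmaxF (n : nat) (F : set 'M[C]_n) (X Y : 'M[C]_n) : \bar R :=
  ereal_inf [set l%:E | l in [set l : R | le_cone F X (rC l *: Y)]].

(* R_F(rho) = min_{sigma in F} R_max(rho || sigma) *)
Definition RF (n : nat) (F : set 'M[C]_n) (rho : 'M[C]_n) : \bar R :=
  ereal_inf [set Rmax rho s | s in F].

(* R^F_F(rho) = min_{sigma in F} R^F_max(rho || sigma) *)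
Definition RFF (n : nat) (F : set 'M[C]_n) (rho : 'M[C]_n) : \bar R :=
  ereal_inf [set RmaxF F rho s | s in F].

(* Omega_F(rho) = inf_{sigma in F} R_max(rho||sigma) R_max(sigma||rho) *)
Definition OmegaF (n : nat) (F : set 'M[C]_n) (rho : 'M[C]_n) : \bar R :=
  ereal_inf [set (Rmax rho s * Rmax s rho)%E | s in F].

(* inverse on extended reals: 0^-1 = +oo, (+oo)^-1 = 0 *)
Definition einv (x : \bar R) : \bar R :=
  match x with
  | EFin r => if r == 0 then +oo%E else (r^-1)%:E
  | +oo%E => 0%E
  | -oo%E => 0%E
  end.

(* the threshold ( Om / (Rr - 1) + 1 )^-1, with c / +oo = 0 *)
Definition threshold (Om Rr : \bar R) : \bar R :=
  einv (Om * einv (Rr - 1%:E) + 1%:E)%E.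

(* --- fidelity ------------------------------------------------------------ *)
Definition adj (n : nat) (A : 'M[C]_n) : 'M[C]_n := (map_mx Num.conj A)^T.

(* the positive semidefinite square root *)
Definition msqrt (n : nat) (A : 'M[C]_n) : 'M[C]_n :=
  match pselect (exists B : 'M[C]_n, psd B /\ B *m B = A) with
  | left H => projT1 (cid H)
  | right _ => 0
  end.

Definition trnorm (n : nat) (X : 'M[C]_n) : C := \tr (msqrt (adj X *m X)).

(* F(rho, sigma) = || sqrt rho sqrt sigma ||_1 ^ 2 *)
Definition fidelity (n : nat) (rho sigma : 'M[C]_n) : C :=
  trnorm (msqrt rho *m msqrt sigma) ^+ 2.

(* --- free operations ----------------------------------------------------- *)
Definition Clinear (n m : nat) (E : 'M[C]_n -> 'M[C]_m) : Prop :=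
  forall (a : C) A B, E (a *: A + B) = a *: E A + E B.

(* complete positivity: id_k \otimes E is positive for every k; an operator
   on C^k \otimes C^n is indexed by 'I_k * 'I_n, its (i,j) block being
   \matrix_(a,b) X (i,a) (j,b) *)
Definition CP (n m : nat) (E : 'M[C]_n -> 'M[C]_m) : Prop :=
  forall (k : nat) (X : 'I_k * 'I_n -> 'I_k * 'I_n -> C), psdF X ->
    psdF (fun (p q : 'I_k * 'I_m) =>
            E (\matrix_(a, b) X (p.1, a) (q.1, b)) p.2 q.2).

Definition trace_nonincreasing (n m : nat) (E : 'M[C]_n -> 'M[C]_m) : Prop :=
  forall A, psd A -> \tr (E A) <= \tr A.

(* the class O of resource-non-generating (probabilistic) operations *)
Definition free_op (n m : nat) (F : set 'M[C]_n) (F' : set 'M[C]_m)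
    (E : 'M[C]_n -> 'M[C]_m) : Prop :=
  [/\ Clinear E, CP E, trace_nonincreasing E &
      forall s, F s -> exists2 s', F' s' &
        exists2 p : R, 0 <= p <= 1 & E s = rC p *: s'].

(* existence of a probabilistic transformation rho -> tau *)
Definition prob_trans (n m : nat) (F : set 'M[C]_n) (F' : set 'M[C]_m)
    (rho : 'M[C]_n) (tau : 'M[C]_m) : Prop :=
  in_closure [set (\tr (E rho))^-1 *: E rho |
               E in [set E | free_op F F' E /\ 0 < \tr (E rho)]] tau.

End QRT.

(* Main.v *)
(** Duality: for [g < Omega_F(rho)] there are positive operators [A], [B] with
    [tr (A s) <= tr (B s)] on all free [s] and [tr (A rho) > g tr (B rho)]. If
    [l sigma - phi = (l - 1) omega] with [sigma], [omega] free, the map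
    [X |-> tr (A X) phi + (l - 1) tr (B X) omega] is, up to rescaling, a
    resource-non-generating operation, because
    [a phi + b (l - 1) omega = a l sigma + (b - a) (l - 1) omega].
    It sends [rho] to a multiple of a state whose overlap with [phi] is at least
    [g / (g + l - 1)], and the overlap with a pure state is the fidelity.
    In the affine case the cone of [F] may be replaced by its real span, which
    gives [tr (A s) = tr (B s)], so that [omega] need not be free.

    The operators [A], [B] are the residuals at a minimiser of
    [|S - P - rho|^2 + |g rho - S - Q|^2] over [S] in the cone and positive
    slacks [P], [Q]. Compactness provides this minimiser, and it also replaces states
    reaching the threshold up to [d > 0] by one state reaching it exactly. *)
Require Import Defs.
From HB Require Import structures.
From mathcomp Require Import all_boot all_order all_algebra.
From mathcomp Require Import all_classical all_reals all_analysis.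
From mathcomp Require Import complex spectral sesquilinear.
From mathcomp Require Import ring lra.
Import Order.TTheory GRing.Theory Num.Theory.
Set Implicit Arguments.
Unset Strict Implicit.
Unset Printing Implicit Defensive.
Local Open Scope ring_scope.
Local Open Scope classical_set_scope.

(** * Positive semidefinite matrices: Gram forms, square roots, trace bounds *)

Section PSD.
Variable R : realType.
Local Notation C := R[i].

Lemma rCD (x y : R) : rC (x + y) = rC x + rC y.
Proof. exact: (rmorphD (real_complex R)). Qed.

Lemma rCN (x : R) : rC (- x) = - rC x.
Proof. exact: (rmorphN (real_complex R)). Qed.

Lemma rCM (x y : R) : rC (x * y) = rC x * rC y.
Proof. exact: (rmorphM (real_complex R)). Qed.

Lemma rCV (x : R) : rC x^-1 = (rC x)^-1.
Proof. exact: (fmorphV (real_complex R)). Qed.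

Lemma rC_sum (I : finType) (f : I -> R) : rC (\sum_i f i) = \sum_i rC (f i).
Proof. exact: (rmorph_sum (real_complex R)). Qed.

Lemma rC0 : rC 0 = 0 :> C. Proof. by []. Qed.

Lemma rC1 : rC 1 = 1 :> C. Proof. by []. Qed.

Lemma ler_rC (x y : R) : (rC x <= rC y) = (x <= y).
Proof. exact: lecR. Qed.

Lemma ltr_rC (x y : R) : (rC x < rC y) = (x < y).
Proof. exact: ltcR. Qed.

Lemma rC_ge0 (x : R) : (0 <= rC x) = (0 <= x).
Proof. exact: ler0c. Qed.

Lemma Re_ge0 (z : C) : 0 <= z -> 0 <= complex.Re z.
Proof. by rewrite lecE => /andP[]. Qed.

Lemma rC_Re (z : C) : 0 <= z -> rC (complex.Re z) = z.
Proof. by move=> z0; rewrite -[RHS](RRe_real (ger0_real z0)). Qed.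

Definition qform (I : finType) (A : I -> I -> C) (v : I -> C) : C :=
  \sum_i \sum_j ((v i)^* * A i j * v j).

Lemma adjE n (A : 'M[C]_n) i j : adj A i j = (A j i)^*.
Proof. by rewrite !mxE. Qed.

Lemma adjM n (A B : 'M[C]_n) : adj (A *m B) = adj B *m adj A.
Proof. by rewrite /adj map_mxM trmx_mul. Qed.

Lemma psd_adj n (A : 'M[C]_n) : psd A -> adj A = A.
Proof. by case=> h _; apply/matrixP => i j; rewrite adjE -h. Qed.

Lemma psdF_gram (I J : finType) (G : J -> I -> C) :
  psdF (fun i j => \sum_c (G c i)^* * G c j).
Proof.
split=> [i j|v].
  rewrite rmorph_sum /=; apply: eq_bigr => c _.
  by rewrite rmorphM /= conjCK mulrC.
suff -> : \sum_i \sum_j (v i)^* * (\sum_c (G c i)^* * G c j) * v j =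
          \sum_c `|\sum_i G c i * v i| ^+ 2.
  by apply: sumr_ge0 => c _; rewrite exprn_ge0.
transitivity (\sum_i \sum_j \sum_c ((G c i * v i)^* * (G c j * v j))).
  apply: eq_bigr => i _; apply: eq_bigr => j _.
  rewrite mulr_sumr mulr_suml; apply: eq_bigr => c _.
  by rewrite rmorphM /=; ring.
under eq_bigr do rewrite exchange_big.
rewrite exchange_big; apply: eq_bigr => c _.
rewrite normCKC rmorph_sum /= mulr_suml; apply: eq_bigr => i _.
by rewrite mulr_sumr.
Qed.

Lemma psdFD (I : finType) (A B : I -> I -> C) :
  psdF A -> psdF B -> psdF (fun i j => A i j + B i j).
Proof.
move=> [hA pA] [hB pB]; split=> [i j|v]; first by rewrite rmorphD /= hA hB.
rewrite (_ : \sum_i _ = qform A v + qform B v); first exact: addr_ge0 (pA v) (pB v).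
rewrite /qform -big_split; apply: eq_bigr => i _; rewrite -big_split /=.
by apply: eq_bigr => j _; rewrite mulrDr mulrDl.
Qed.

Lemma psdF_sum (I J : finType) (A : J -> I -> I -> C) :
  (forall c, psdF (A c)) -> psdF (fun i j => \sum_c A c i j).
Proof.
move=> h; split=> [i j|v].
  by rewrite rmorph_sum /=; apply: eq_bigr => c _; case: (h c) => ->.
rewrite (_ : \sum_i _ = \sum_c qform (A c) v).
  by apply: sumr_ge0 => c _; case: (h c) => _; apply.
under eq_bigr do under eq_bigr do rewrite mulr_sumr mulr_suml.
under eq_bigr do rewrite exchange_big.
by rewrite exchange_big.
Qed.

Lemma psdF_scale (I : finType) (A : I -> I -> C) (a : C) :
  0 <= a -> psdF A -> psdF (fun i j => a * A i j).
Proof.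
move=> a0 [hA pA]; split=> [i j|v].
  by rewrite rmorphM /= hA (geC0_conj a0).
rewrite (_ : \sum_i _ = a * qform A v); first exact: mulr_ge0 a0 (pA v).
rewrite /qform mulr_sumr; apply: eq_bigr => i _.
by rewrite mulr_sumr; apply: eq_bigr => j _; ring.
Qed.

Lemma psdD n (A B : 'M[C]_n) : psd A -> psd B -> psd (A + B).
Proof.
move=> hA hB; rewrite /psd (_ : (fun i j => _) = fun i j => A i j + B i j).
  exact: psdFD.
by apply/funext => i; apply/funext => j; rewrite mxE.
Qed.

Lemma psdZ n (A : 'M[C]_n) (a : C) : 0 <= a -> psd A -> psd (a *: A).
Proof.
move=> a0 hA; rewrite /psd (_ : (fun i j => _) = fun i j => a * A i j).
  exact: psdF_scale.
by apply/funext => i; apply/funext => j; rewrite mxE.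
Qed.

Lemma psd0 n : psd (0 : 'M[C]_n).
Proof.
split=> [i j|v]; first by rewrite !mxE conjC0.
by rewrite big1 // => i _; rewrite big1 // => j _; rewrite mxE mulr0 mul0r.
Qed.

Lemma psd_spectral n (A : 'M[C]_n) : psd A ->
  exists P : 'M[C]_n, exists d : 'rV[C]_n,
    [/\ forall c, 0 <= d 0 c, P *m adj P = 1%:M & A = adj P *m diag_mx d *m P].
Proof.
move=> pA; have hA := psd_adj pA; case: pA => _ pA.
have adjt (B : 'M[C]_n) : (B ^t*)%sesqui = adj B.
  by apply/matrixP => i j; rewrite !mxE.
have nA : A \is normalmx by apply/normalmxP; rewrite !adjt hA.
have /orthomx_spectralP := nA; set P := spectralmx A; set d := spectral_diag A.
have uP : P \is unitarymx by exact: spectral_unitarymx.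
rewrite invmx_unitary // adjt => eA; exists P, d; split=> //; last first.
  by have /unitarymxP := uP; rewrite adjt.
move=> c.
have PP : P *m adj P = 1%:M by have /unitarymxP := uP; rewrite adjt.
have eD : diag_mx d = P *m A *m adj P.
  by rewrite eA !mulmxA PP mul1mx -mulmxA PP mulmx1.
have := congr1 (fun M : 'M[C]_n => M c c) eD.
rewrite mxE eqxx mulr1n => ->.
(* The eigenvalue [d 0 c] is the quadratic form of [A] at the conjugate of row [c] of [P]. *)
have := pA (fun i => (P c i)^*).
rewrite (_ : \sum_i _ = (P *m A *m adj P) c c) //.
rewrite -mulmxA mxE; apply: eq_bigr => i _; rewrite mxE mulr_sumr.
by apply: eq_bigr => j _; rewrite adjE conjCK mulrA.
Qed.

Lemma spectral_entry n (P : 'M[C]_n) (d : 'rV[C]_n) i j :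
  (adj P *m diag_mx d *m P) i j = \sum_c (P c i)^* * d 0 c * P c j.
Proof.
rewrite mxE; apply: eq_bigr => c _; congr (_ * _).
by rewrite mul_mx_diag mxE adjE.
Qed.

(** The rows of the diagonalising unitary are scaled by square roots of the eigenvalues. Traces and
    forms involving [A] then split into rank-one terms. *)
Lemma psd_gram n (A : 'M[C]_n) : psd A ->
  exists G : 'M[C]_n, forall i j, A i j = \sum_c (G c i)^* * G c j.
Proof.
move=> /psd_spectral[P [d [d0 _ ->]]].
exists (\matrix_(c, i) (sqrtC (d 0 c) * P c i)) => i j.
rewrite spectral_entry; apply: eq_bigr => c _; rewrite !mxE rmorphM /=.
rewrite (@geC0_conj _ (sqrtC _)) ?sqrtC_ge0 //.
have := sqrtCK (d 0 c); set t := sqrtC _ => <-; by ring.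
Qed.

Lemma psd_has_sqrt n (A : 'M[C]_n) : psd A ->
  exists B : 'M[C]_n, psd B /\ B *m B = A.
Proof.
move=> /psd_spectral[P [d [d0 PP ->]]].
pose s : 'rV[C]_n := \row_c sqrtC (d 0 c).
exists (adj P *m diag_mx s *m P); split.
  (* The Gram form of the root needs fourth roots of the eigenvalues, since [s] already holds square
     roots. *)
  rewrite /psd (_ : (fun i j => _) = fun i j => \sum_c
     ((fun c i => sqrtC (s 0 c) * P c i) c i)^*
      * (fun c i => sqrtC (s 0 c) * P c i) c j).
    exact: psdF_gram.
  apply/funext => i; apply/funext => j; rewrite spectral_entry.
  apply: eq_bigr => c _; rewrite rmorphM /=.
  have s0 : 0 <= s 0 c by rewrite mxE sqrtC_ge0.
  rewrite (@geC0_conj _ (sqrtC _)) ?sqrtC_ge0 //.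
  have := sqrtCK (s 0 c); set t := sqrtC _ => <-; by ring.
rewrite !mulmxA -[_ *m P *m adj P]mulmxA PP mulmx1.
congr (_ *m _); rewrite -mulmxA mulmx_diag; congr (_ *m diag_mx _).
by apply/rowP => c; rewrite !mxE -expr2 sqrtCK.
Qed.

Lemma msqrtP n (A : 'M[C]_n) : psd A -> psd (msqrt A) /\ msqrt A *m msqrt A = A.
Proof.
move=> /psd_has_sqrt h; rewrite /msqrt.
by case: pselect => // h'; case: (cid h').
Qed.

Lemma psd_diag_ge0 n (A : 'M[C]_n) i : psd A -> 0 <= A i i.
Proof.
move=> /psd_gram[G ->]; apply: sumr_ge0 => c _.
by rewrite -normCKC exprn_ge0.
Qed.

Lemma psd_trace_ge0 n (A : 'M[C]_n) : psd A -> 0 <= \tr A.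
Proof. by move=> pA; apply: sumr_ge0 => i _; apply: psd_diag_ge0. Qed.

Lemma psd_diag_le_trace n (A : 'M[C]_n) i : psd A -> A i i <= \tr A.
Proof.
move=> pA; rewrite /mxtrace (bigD1 i) //= lerDl.
by apply: sumr_ge0 => j _; apply: psd_diag_ge0.
Qed.

(** In Gram form, [2 |x| |y| <= |x|^2 + |y|^2] bounds twice the modulus by [A i i + A j j]. *)
Lemma psd_entry_le n (A : 'M[C]_n) i j : psd A -> `|A i j| <= \tr A.
Proof.
move=> pA; have [G eG] := psd_gram pA.
have h : `|A i j| * 2 <= A i i + A j j.
  rewrite !eG -big_split /=.
  apply: le_trans (ler_wpM2r _ (ler_norm_sum _ _ _)) _ => //.
  rewrite mulr_suml; apply: ler_sum => c _.
  rewrite -!normCKC normrM norm_conjC -subr_ge0.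
  rewrite (_ : _ - _ = (`|G c i| - `|G c j|) ^+ 2); last by ring.
  by rewrite real_exprn_even_ge0 // rpredB // normr_real.
rewrite -(ler_pM2r (ltr0n _ 2)); apply: le_trans h _.
by rewrite mulrDr mulr1 lerD // psd_diag_le_trace.
Qed.

Lemma psd_trace0 n (A : 'M[C]_n) : psd A -> \tr A = 0 -> A = 0.
Proof.
move=> pA t0; apply/matrixP => i j; rewrite mxE; apply/eqP.
by rewrite -normr_le0 -t0 psd_entry_le.
Qed.

Lemma trace_mul_entries n (A B : 'M[C]_n) :
  \tr (A *m B) = \sum_i \sum_j A i j * B j i.
Proof. by apply: eq_bigr => i _; rewrite mxE. Qed.

(** The Gram form of [A] turns the trace into a sum of quadratic forms of [B], one per row of
    [G]. *)
Lemma psd_trace_mul_ge0 n (A B : 'M[C]_n) : psd A -> psd B -> 0 <= \tr (A *m B).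
Proof.
move=> /psd_gram[G eG] [_ pB]; rewrite trace_mul_entries.
under eq_bigr do under eq_bigr do rewrite eG mulr_suml.
under eq_bigr do rewrite exchange_big.
rewrite exchange_big; apply: sumr_ge0 => c _ /=.
have := pB (fun i => (G c i)^*); rewrite exchange_big /=.
rewrite (_ : \sum_i _ = \sum_i \sum_j (G c i)^* * G c j * B j i) //.
by apply: eq_bigr => i _; apply: eq_bigr => j _; rewrite conjCK; ring.
Qed.

(** Entries of [X] are at most [\tr X], so the sum of the moduli of the entries of [A] serves;
    adding [1] makes it positive. *)
Lemma psd_trace_mul_le n (A : 'M[C]_n) : psd A ->
  exists2 M : R, 0 < M & forall X, psd X -> \tr (A *m X) <= rC M * \tr X.
Proof.
move=> pA; pose s := \sum_i \sum_j `|A i j|.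
have s0 : 0 <= s by apply: sumr_ge0 => i _; apply: sumr_ge0.
exists (complex.Re s + 1).
  by move: s0; rewrite lecE /= => /andP[_ ?]; rewrite ltr_wpDl.
have -> : rC (complex.Re s + 1) = s + 1.
  rewrite -[RHS](RRe_real (x := s + 1)) ?rpredD ?ger0_real ?ler01 //.
  by rewrite raddfD.
move=> X pX; apply: le_trans (_ : s * \tr X <= _); last first.
  by rewrite ler_wpM2r ?psd_trace_ge0 // lerDl.
rewrite -(ger0_norm (psd_trace_mul_ge0 pA pX)) trace_mul_entries.
apply: le_trans (ler_norm_sum _ _ _) _; rewrite mulr_suml; apply: ler_sum => i _.
apply: le_trans (ler_norm_sum _ _ _) _; rewrite mulr_suml; apply: ler_sum => j _.
by rewrite normrM ler_wpM2l // psd_entry_le.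
Qed.
End PSD.

(** * Rank-one projections, fidelity with a pure state, measure-and-prepare maps *)

Section Maps.
Variable R : realType.
Local Notation C := R[i].

(** A rank-one [phi] is a column [u] times a row [w], and [w *m X *m u] is a scalar. *)
Lemma pure_sandwich n (phi X : 'M[C]_n) : pure phi ->
  phi *m X *m phi = \tr (phi *m X) *: phi.
Proof.
move=> [_ rk]; have := mulmx_base phi; move: (col_base phi) (row_base phi).
rewrite rk => u w <-.
have -> : u *m w *m X *m (u *m w) = u *m (w *m X *m u) *m w by rewrite !mulmxA.
have -> : \tr (u *m w *m X) = \tr (w *m X *m u).
  by rewrite -mulmxA mxtrace_mulC.
rewrite [w *m X *m u]mx11_scalar.
by rewrite mul_mx_scalar mxtrace_scalar mulr1n -scalemxAl.
Qed.

Lemma pure_idem n (phi : 'M[C]_n) : pure phi -> phi *m phi = phi.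
Proof.
move=> pp; have := pure_sandwich 1%:M pp; rewrite mulmx1 => ->.
by case: pp => [[_ ->] _]; rewrite scale1r.
Qed.

Lemma adj_mul_eq0 n (N : 'M[C]_n) : adj N *m N = 0 -> N = 0.
Proof.
move=> h; apply/matrixP => i j; rewrite mxE.
have := congr1 (fun M : 'M[C]_n => M j j) h; rewrite !mxE => /eqP.
rewrite psumr_eq0 => [/allP /(_ i)|c _]; last first.
  by rewrite adjE -normCKC exprn_ge0.
by rewrite mem_index_enum adjE -normCKC expf_eq0 /= normr_eq0 => /(_ isT)/eqP.
Qed.

(** [msqrt] is picked by choice, so an arbitrary positive root [B] has to be identified. For
    [N = B (1 - phi)], [adj N *m N] is [f (1 - phi) phi (1 - phi) = 0]; hence [B = phi B phi], a
    multiple of [phi]. *)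
Lemma sqrt_scaled_pure n (phi B : 'M[C]_n) (f : C) : pure phi -> psd B ->
  B *m B = f *: phi -> B = \tr B *: phi /\ \tr B ^+ 2 = f.
Proof.
move=> pp pB BB; have idem := pure_idem pp.
have aphi : adj phi = phi by case: pp => [[/psd_adj]].
have aB := psd_adj pB.
have Bphi : B *m phi = B.
  apply/esym/eqP; rewrite -subr_eq0; apply/eqP/adj_mul_eq0.
  have -> : B - B *m phi = B *m (1%:M - phi) by rewrite mulmxBr mulmx1.
  rewrite adjM aB mulmxA -[_ *m B *m B]mulmxA BB -scalemxAr -scalemxAl.
  by rewrite -mulmxA mulmxBr mulmx1 idem subrr mulmx0 scaler0.
have phiB : phi *m B = B by have := congr1 (@adj R n) Bphi; rewrite adjM aphi aB.
have eB : B = \tr B *: phi.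
  by have := pure_sandwich B pp; rewrite phiB Bphi.
split=> //; have := congr1 mxtrace BB.
rewrite {1 2}eB -scalemxAl -scalemxAr idem !mxtraceZ.
by case: pp => [[_ ->] _]; rewrite !mulr1 expr2.
Qed.

Lemma fidelity_pure n (tau phi : 'M[C]_n) : density tau -> pure phi ->
  fidelity tau phi = \tr (phi *m tau).
Proof.
move=> [ptau _] pp; have pphi : psd phi by case: pp => [[]].
have [pT TT] := msqrtP ptau; have [pB BB] := msqrtP pphi.
(* The root is [t phi] with [t] its trace; [t >= 0] and [t^2 = 1] force [t = 1]. *)
have sphi : msqrt phi = phi.
  have [|e t2] := @sqrt_scaled_pure _ phi _ 1 pp pB; first by rewrite scale1r.
  suff t1 : \tr (msqrt phi) = 1 by rewrite e t1 scale1r.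
  by apply/eqP; rewrite -(@eqrXn2 _ 2) ?ler01 ?psd_trace_ge0 // t2 expr1n.
have f0 := psd_trace_mul_ge0 pphi ptau.
have [pN NN] := msqrtP (psdZ f0 pphi).
(* The matrix under the root of the trace norm is [phi tau phi], that is [tr (phi tau) phi]. *)
rewrite /fidelity sphi /trnorm adjM (psd_adj pT) (psd_adj pphi) mulmxA.
rewrite -[phi *m _ *m _]mulmxA TT pure_sandwich //.
by have [] := sqrt_scaled_pure pp pN NN.
Qed.

Lemma fidelity_ge0 n (tau phi : 'M[C]_n) : 0 <= fidelity tau phi.
Proof.
rewrite exprn_ge0 // /trnorm psd_trace_ge0 // /msqrt.
by case: pselect => [h|_]; [case: (cid h) => ? [] | exact: psd0].
Qed.

Lemma sum_pair (I J : finType) (f : I * J -> C) :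
  \sum_p f p = \sum_i \sum_j f (i, j).
Proof. by rewrite pair_bigA; apply: eq_bigr => -[]. Qed.

(** The form at [v] is the form of [X] at the product of [v] with the conjugate of [g]. *)
Lemma psdF_compress (I J : finType) (X : I * J -> I * J -> C) (g : J -> C) :
  psdF X -> psdF (fun i j => \sum_b \sum_a (g b)^* * g a * X (i, a) (j, b)).
Proof.
move=> [hX pX]; split=> [i j|v].
  rewrite rmorph_sum exchange_big /=; apply: eq_bigr => b _.
  rewrite rmorph_sum /=; apply: eq_bigr => a _.
  by rewrite !rmorphM /= conjCK -hX; ring.
have := pX (fun p => (g p.2)^* * v p.1).
rewrite (_ : \sum_p _ = \sum_i \sum_j
  (v i)^* * (\sum_b \sum_a (g b)^* * g a * X (i, a) (j, b)) * v j) //.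
rewrite sum_pair; apply: eq_bigr => i _.
under eq_bigr do rewrite sum_pair.
rewrite exchange_big; apply: eq_bigr => j _.
rewrite exchange_big mulr_sumr mulr_suml; apply: eq_bigr => b _.
rewrite mulr_sumr mulr_suml; apply: eq_bigr => a _ /=.
by rewrite rmorphM /= conjCK; ring.
Qed.

(** The form at [v] is the form of [S] at the contraction of [v] with [h]. *)
Lemma psdF_tensor_rank1 (I J : finType) (S : I -> I -> C) (h : J -> C) :
  psdF S -> psdF (fun p q : I * J => S p.1 q.1 * ((h p.2)^* * h q.2)).
Proof.
move=> [hS pS]; split=> [p q|v].
  by rewrite !rmorphM /= conjCK -hS; ring.
have := pS (fun i => \sum_s h s * v (i, s)).
rewrite (_ : \sum_i _ = \sum_p \sum_q
  ((v p)^* * (S p.1 q.1 * ((h p.2)^* * h q.2)) * v q)) //.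
rewrite sum_pair; apply: eq_bigr => i _.
under [RHS]eq_bigr do rewrite sum_pair.
rewrite exchange_big; apply: eq_bigr => j _.
rewrite rmorph_sum -mulrA mulr_suml; apply: eq_bigr => s _ /=.
rewrite rmorphM !mulr_sumr; apply: eq_bigr => t _ /=.
by ring.
Qed.

(** This is complete positivity of [X |-> tr (A X) W]; Gram forms of [A] and [W] reduce it to the
    two rank-one cases above. *)
Lemma psdF_tensor_trace (k n m : nat) (X : 'I_k * 'I_n -> 'I_k * 'I_n -> C)
    (A : 'M[C]_n) (W : 'M[C]_m) : psdF X -> psd A -> psd W ->
  psdF (fun p q : 'I_k * 'I_m =>
    \tr (A *m \matrix_(a, b) X (p.1, a) (q.1, b)) * W p.2 q.2).
Proof.
move=> pX /psd_gram[G eG] /psd_gram[H eH].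
have -> : (fun p q : 'I_k * 'I_m =>
    \tr (A *m \matrix_(a, b) X (p.1, a) (q.1, b)) * W p.2 q.2) =
  fun p q => \sum_c \sum_d
    (\sum_b \sum_a (G c b)^* * G c a * X (p.1, a) (q.1, b)) *
     ((H d p.2)^* * H d q.2).
  apply/funext => p; apply/funext => q.
  rewrite trace_mul_entries eH.
  under eq_bigr do under eq_bigr do rewrite eG mxE mulr_suml.
  under eq_bigr do rewrite exchange_big.
  rewrite exchange_big mulr_suml; apply: eq_bigr => c _.
  by rewrite mulr_sumr.
apply: psdF_sum => c; apply: psdF_sum => d.
exact: (psdF_tensor_rank1 _ (psdF_compress (G c) pX)).
Qed.

Lemma measure_prepare_free_op n m (F : set 'M[C]_n) (F' : set 'M[C]_m)
    (A B : 'M[C]_n) (phi W : 'M[C]_m) : psd A -> psd B -> psd phi -> psd W ->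
  (forall s, F s -> density s) ->
  (forall s, F' s -> density s) ->
  (forall s, F s -> cone F' (\tr (A *m s) *: phi + \tr (B *m s) *: W)) ->
  exists2 c : R, 0 < c & free_op F F'
     (fun X => rC c *: (\tr (A *m X) *: phi + \tr (B *m X) *: W)).
Proof.
move=> pA pB pphi pW dF dF' free.
have [M M0 hM] := psd_trace_mul_le pA; have [N N0 hN] := psd_trace_mul_le pB.
have tphi := psd_trace_ge0 pphi; have tW := psd_trace_ge0 pW.
(* [M tr phi + N tr W] bounds the gain in trace; the extra [1] keeps the denominator positive. *)
pose c : R := (M * complex.Re (\tr phi) + N * complex.Re (\tr W) + 1)^-1.
have c0' : 0 < M * complex.Re (\tr phi) + N * complex.Re (\tr W) + 1.
  by rewrite ltr_wpDl // addr_ge0 // mulr_ge0 ?Re_ge0 // ltW.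
have c0 : 0 < c by rewrite invr_gt0.
have rc0 : 0 <= rC c by rewrite rC_ge0 ltW.
have tni : trace_nonincreasing
    (fun X => rC c *: (\tr (A *m X) *: phi + \tr (B *m X) *: W)).
  move=> X pX; rewrite mxtraceZ mxtraceD !mxtraceZ.
  have tX := psd_trace_ge0 pX.
  apply: le_trans (_ : rC c * ((rC M * \tr phi + rC N * \tr W) * \tr X) <= _).
    apply: ler_wpM2l => //; rewrite mulrDl; apply: lerD.
      by rewrite mulrAC ler_wpM2r // hM.
    by rewrite mulrAC ler_wpM2r // hN.
  rewrite mulrA; apply: ler_piMl => //.
  rewrite -(rC_Re tphi) -(rC_Re tW) -!rCM -rCD -rCM -rC1 ler_rC.
  rewrite /c mulrC ler_pdivrMr // mul1r.
  by rewrite lerDl.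
exists c => //; split=> //.
- move=> a X Y; rewrite !mulmxDr -!scalemxAr !mxtraceD !mxtraceZ.
  apply/matrixP => i j; rewrite !mxE; ring.
- move=> k X pX.
  pose E1 (p q : 'I_k * 'I_m) :=
    \tr (A *m \matrix_(a, b) X (p.1, a) (q.1, b)) * phi p.2 q.2.
  pose E2 (p q : 'I_k * 'I_m) :=
    \tr (B *m \matrix_(a, b) X (p.1, a) (q.1, b)) * W p.2 q.2.
  rewrite (_ : (fun p q => _) = fun p q => rC c * (E1 p q + E2 p q)).
    by apply: psdF_scale => //; apply: psdFD; apply: psdF_tensor_trace.
  by apply/funext => p; apply/funext => q; rewrite !mxE.
- move=> s Fs; have [l l0 [s' Fs' e]] := free _ Fs.
  exists s' => //; exists (c * l); last first.
    by rewrite e scalerA rCM.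
  rewrite (mulr_ge0 (ltW c0) l0) /=.
  (* [c * l <= 1] is trace non-increase at [s], because [s] and [s'] have unit trace. *)
  have [ps ts] := dF _ Fs; have [_ ts'] := dF' _ Fs'.
  have := tni s ps; rewrite e !mxtraceZ ts' ts mulr1.
  by rewrite -rCM -rC1 ler_rC.
Qed.
End Maps.

(** * Cluster points of bounded families, and conditions that pass to closures *)

Section Compactness.
Variable R : realType.
Local Notation C := R[i].

Definition adherent (I : Type) (S : set (I -> C)) (x : I -> C) : Prop :=
  forall e : R, 0 < e -> exists2 y, S y & forall i, `|y i - x i| < rC e.

(** The sets [P d] generate a proper filter on a box, compact by Tychonoff; a cluster point of the
    filter adheres to every [P d]. *)
Lemma real_bounded_cluster (I : finType) (P : R -> set (I -> R)) (M : R) :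
  (forall d d', d <= d' -> P d `<=` P d') ->
  (forall d, 0 < d -> P d !=set0) ->
  (forall d x, 0 < d -> P d x -> forall i, `|x i| <= M) ->
  exists x : I -> R, forall d e, 0 < d -> 0 < e ->
    exists2 y, P d y & forall i, `|y i - x i| < e.
Proof.
move=> mono ne bnd.
pose K := [set f : prod_topology (fun _ : I => R^o) |
           forall i, `[-M, M]%classic (f i)].
have cK : compact K.
  exact: (@tychonoff _ (fun _ => R^o) (fun _ => `[-M, M]%classic)
          (fun _ => @segment_compact _ _ _)).
pose G : set_system (prod_topology (fun _ : I => R^o)) :=
  [set A | exists2 d, 0 < d & P d `<=` A].
have pG : ProperFilter G.
  split.
    by move=> [d d0 h]; have [x Px] := ne d d0; exact: (h x Px).
  split.
  - by exists 1.
  - move=> A B [d d0 dA] [d' d'0 dB]; exists (Num.min d d').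
      by rewrite lt_min d0.
    move=> x Px; split; [apply: dA | apply: dB]; apply: mono Px.
      by rewrite ge_min lexx.
    by rewrite ge_min lexx orbT.
  - by move=> A B AB [d d0 dA]; exists d => // x /dA /AB.
have GK : G K.
  exists 1 => // x /(bnd _ _ ltr01) h i /=.
  by rewrite in_itv /= -ler_norml.
have [x [_ clx]] := cK G pG GK.
exists x => d e d0 e0.
have GP : G (P d) by exists d.
have Nx : nbhs x [set y : prod_topology (fun _ : I => R^o) |
                  forall i, `|y i - x i| < e].
  pose f i := [set y : prod_topology (fun _ : I => R^o) | `|y i - x i| < e].
  suff near_f i : nbhs x (f i) by exact: (@filter_forall _ I f (nbhs x) _ near_f).
  have : nbhs (x i) [set z : R^o | `|z - x i| < e].
    by apply/nbhs_ballP; exists e => // z; rewrite /ball /= distrC.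
  exact: (@proj_continuous I (fun=> R^o) i x).
have [y [Py hy]] := clx _ _ GP Nx.
by exists y.
Qed.

Lemma norm_le_ReIm (z : C) : `|z| <= rC (`|complex.Re z| + `|complex.Im z|).
Proof.
rewrite normc_def ler_rC -(ger0_norm (addr_ge0 (normr_ge0 (complex.Re z))
  (normr_ge0 (complex.Im z)))) -sqrtr_sqr ler_wsqrtr //.
rewrite sqrrD !real_normK ?num_real // lerD2r lerDl.
by rewrite mulrn_wge0 // mulr_ge0.
Qed.

Lemma Re_le_norm (z : C) (x : R) : `|z| <= rC x -> `|complex.Re z| <= x.
Proof. by move=> h; rewrite -ler_rC; apply: le_trans (normc_ge_Re z) h. Qed.

Lemma Im_le_norm (z : C) (x : R) : `|z| <= rC x -> `|complex.Im z| <= x.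
Proof.
move=> h; rewrite -normrN -ReiNIm; apply: Re_le_norm.
by rewrite normrM (_ : `|Complex 0 1| = 1) ?mulr1 // normCi.
Qed.

Lemma bounded_cluster (I : finType) (P : R -> set (I -> C)) (M : R) :
  (forall d d', d <= d' -> P d `<=` P d') ->
  (forall d, 0 < d -> P d !=set0) ->
  (forall d x, 0 < d -> P d x -> forall i, `|x i| <= rC M) ->
  exists x : I -> C, forall d, 0 < d -> adherent (P d) x.
Proof.
move=> mono ne bnd.
pose cpl (g : bool * I -> R) i : C := Complex (g (true, i)) (g (false, i)).
have [] := @real_bounded_cluster _ (fun d => [set g | P d (cpl g)]) M.
- by move=> d d' dd' g /=; exact: mono.
- move=> d /ne[x Px].
  exists (fun p => if p.1 then complex.Re (x p.2) else complex.Im (x p.2)).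
  by rewrite /= (_ : cpl _ = x) //; apply/funext => i; rewrite /cpl /=; case: (x i).
- move=> d g d0 /= /(bnd d _ d0) h [[] i].
    exact: (Re_le_norm (h i)).
  exact: (Im_le_norm (h i)).
move=> x hx; exists (cpl x) => d d0 e e0.
have [|y Py hy] := hx d (e / 2) d0; first by rewrite divr_gt0.
exists (cpl y) => // i; apply: le_lt_trans (norm_le_ReIm _) _.
by rewrite ltr_rC [ltRHS]splitr ltrD ?hy.
Qed.

(** Treating the family as one point yields a single [y] close to [x] in all members at once, as
    coupled unknowns require. *)
Lemma family_cluster (T : finType) n (P : R -> set (T -> 'M[C]_n)) (M : R) :
  (forall d d', d <= d' -> P d `<=` P d') ->
  (forall d, 0 < d -> P d !=set0) ->
  (forall d x, 0 < d -> P d x -> forall t i j, `|x t i j| <= rC M) ->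
  exists x : T -> 'M[C]_n, forall d e, 0 < d -> 0 < e ->
    exists2 y, P d y & forall t i j, `|y t i j - x t i j| < rC e.
Proof.
move=> mono ne bnd.
pose mat (g : T * ('I_n * 'I_n) -> C) t : 'M[C]_n := \matrix_(i, j) g (t, (i, j)).
have matK (x : T -> 'M[C]_n) : mat (fun p => x p.1 p.2.1 p.2.2) = x.
  by apply/funext => t; apply/matrixP => i j; rewrite mxE.
have [] := @bounded_cluster _ (fun d => [set g | P d (mat g)]) M.
- by move=> d d' dd' g /=; exact: mono.
- by move=> d /ne[x Px]; exists (fun p => x p.1 p.2.1 p.2.2); rewrite /= matK.
- by move=> d g d0 /= /(bnd d _ d0) h [t [i j]]; have := h t i j; rewrite mxE.
move=> x hx; exists (mat x) => d e d0 e0; have [y Py hy] := hx d d0 e e0.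
by exists (mat y) => // t i j; rewrite !mxE.
Qed.

Lemma matrix_cluster n (P : R -> set 'M[C]_n) (M : R) :
  (forall d d', d <= d' -> P d `<=` P d') ->
  (forall d, 0 < d -> P d !=set0) ->
  (forall d X, 0 < d -> P d X -> forall i j, `|X i j| <= rC M) ->
  exists X : 'M[C]_n, forall d, 0 < d -> in_closure (P d) X.
Proof.
move=> mono ne bnd.
have [] := @family_cluster unit n (fun d => [set x | P d (x tt)]) M.
- by move=> d d' dd' x /=; exact: mono.
- by move=> d /ne[X PX]; exists (fun=> X).
- by move=> d x d0 /= /(bnd d _ d0) h [].
move=> x hx; exists (x tt) => d d0 e e0; have [y Py hy] := hx d e d0 e0.
by exists (y tt).
Qed.

Lemma adherent_Re_ge0 (I : finType) (S : set (I -> C)) x (a : I -> C) (c : R) :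
  adherent S x -> (forall y, S y -> 0 <= c + complex.Re (\sum_i a i * y i)) ->
  0 <= c + complex.Re (\sum_i a i * x i).
Proof.
move=> adh h; rewrite leNgt; apply/negP => v0.
pose M := \sum_i `|a i|.
have M0 : 0 <= M by apply: sumr_ge0.
have rM : 0 < complex.Re M + 1 by rewrite ltr_wpDl ?Re_ge0.
(* Within this radius the value moves by at most [M e], less than the modulus of the supposed
   negative value, so it would be negative at [y] too. *)
pose e := - (c + complex.Re (\sum_i a i * x i)) / (complex.Re M + 1).
have e0 : 0 < e by rewrite divr_gt0 // oppr_gt0.
have [y Sy hy] := adh e e0; have := h y Sy.
rewrite leNgt => /negP; apply.
have : `|\sum_i a i * y i - \sum_i a i * x i| <= rC (complex.Re M * e).
  rewrite -sumrB rCM (rC_Re M0) mulr_suml.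
  apply: le_trans (ler_norm_sum _ _ _) _; apply: ler_sum => i _.
  by rewrite -mulrBr normrM ler_wpM2l // ltW.
move=> /Re_le_norm; rewrite raddfB /= => /(le_trans (ler_norm _)).
have : e * (complex.Re M + 1) = - (c + complex.Re (\sum_i a i * x i)).
  by rewrite /e divfK // gt_eqF.
move: e0; lra.
Qed.

Lemma closure_Re_ge0 n (S : set 'M[C]_n) X (a : 'M[C]_n) (c : R) :
  in_closure S X -> (forall Y, S Y -> 0 <= c + complex.Re (\tr (a *m Y))) ->
  0 <= c + complex.Re (\tr (a *m X)).
Proof.
move=> cX h.
have trE Y : \tr (a *m Y) = \sum_(p : 'I_n * 'I_n) a p.2 p.1 * Y p.1 p.2.
  by rewrite trace_mul_entries exchange_big pair_bigA.
rewrite trE; apply: (@adherent_Re_ge0 _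
  [set y | exists2 Y, S Y & y = fun p => Y p.1 p.2]).
  move=> e /cX[Y SY hY]; exists (fun p => Y p.1 p.2) => //.
  by exists Y.
by move=> y [Y SY ->]; rewrite -trE; apply: h.
Qed.

Lemma closure_ge0 n (S : set 'M[C]_n) X (a : 'M[C]_n) (c : C) :
  in_closure S X -> (forall Y, S Y -> 0 <= c + \tr (a *m Y)) ->
  0 <= c + \tr (a *m X).
Proof.
move=> cX h.
(* [0 <= z] in [C] also says that the imaginary part vanishes; both facts are read off [Re (u z)]
   for [u] equal to [1], [i] and [-i]. *)
have key (u : C) : (forall Y, S Y -> 0 <= complex.Re (u * (c + \tr (a *m Y)))) ->
    0 <= complex.Re (u * (c + \tr (a *m X))).
  move=> hu; rewrite mulrDr raddfD /= -mxtraceZ scalemxAl.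
  apply: (closure_Re_ge0 cX) => Y /hu.
  by rewrite mulrDr raddfD /= -mxtraceZ scalemxAl.
have Re1 (w : C) : complex.Re (1 * w) = complex.Re w by rewrite mul1r.
have Rei (w : C) : complex.Re (Complex 0 1 * w) = - complex.Im w.
  by rewrite mulrC ReiNIm.
have ReNi (w : C) : complex.Re (- Complex 0 1 * w) = complex.Im w.
  by rewrite mulNr raddfN /= Rei opprK.
rewrite lecE /= -Re1 key ?andbT; last first.
  by move=> Y /h /Re_ge0; rewrite Re1.
rewrite eq_le -oppr_ge0 -Rei -ReNi !key // => Y /h;
  rewrite lecE /= => /andP[/eqP w0 _].
  by rewrite ReNi w0.
by rewrite Rei w0 oppr0.
Qed.

Lemma adj_closure n (S : set 'M[C]_n) X :
  in_closure S X -> (forall Y, S Y -> adj Y = Y) -> adj X = X.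
Proof.
move=> cX h; apply/matrixP => i j; rewrite adjE.
apply/eqP; rewrite -subr_eq0; apply/negPn/negP; rewrite -normr_gt0 => z0.
pose r := complex.Re `|(X j i)^* - X i j|.
have rE : rC r = `|(X j i)^* - X i j| by rewrite rC_Re.
have r0 : 0 < r by rewrite -ltr_rC rE.
have [|Y SY hY] := cX (r / 2); first by rewrite divr_gt0.
suff : `|(X j i)^* - X i j| < rC r by rewrite rE ltxx.
rewrite [r]splitr rCD.
apply: le_lt_trans (ltrD (hY j i) (hY i j)).
rewrite (distrC (Y j i)) -(norm_conjC (X j i - Y j i)) rmorphB /= -[(Y j i)^*]adjE.
by rewrite h //; apply: le_trans (ler_normD _ _); rewrite addrA subrK.
Qed.

Lemma psd_closure n (S : set 'M[C]_n) X :
  in_closure S X -> (forall Y, S Y -> psd Y) -> psd X.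
Proof.
move=> cX h; split=> [i j|v].
  by rewrite -adjE (adj_closure cX) // => Y /h /psd_adj.
(* For fixed [v] the quadratic form is a trace against a rank-one matrix, hence linear in [Y]. *)
have e (Y : 'M[C]_n) : \sum_i \sum_j ((v i)^* * Y i j * v j) =
    0 + \tr ((\matrix_(j, i) (v j * (v i)^*)) *m Y).
  rewrite add0r trace_mul_entries exchange_big; apply: eq_bigr => i _.
  by apply: eq_bigr => j _; rewrite mxE; ring.
by rewrite e; apply: (closure_ge0 cX) => Y /h[_ /(_ v)]; rewrite e.
Qed.

Lemma closure_eq n (S : set 'M[C]_n) X (a : 'M[C]_n) (c : C) :
  in_closure S X -> (forall Y, S Y -> \tr (a *m Y) = c) -> \tr (a *m X) = c.
Proof.
move=> cX h; apply/eqP; rewrite eq_le; apply/andP; split; rewrite -subr_ge0.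
  rewrite -raddfN -mulNmx; apply: (closure_ge0 cX) => Y /h e.
  by rewrite mulNmx raddfN /= e subrr.
rewrite addrC; apply: (closure_ge0 cX) => Y /h e.
by rewrite e addNr.
Qed.

Lemma density_closure n (S : set 'M[C]_n) X :
  in_closure S X -> (forall Y, S Y -> density Y) -> density X.
Proof.
move=> cX h; split; first by apply: (psd_closure cX) => Y /h[].
by rewrite -[X]mul1mx; apply: (closure_eq cX) => Y /h[]; rewrite mul1mx.
Qed.

Lemma in_closure_sub n (S S' : set 'M[C]_n) X :
  S `<=` S' -> in_closure S X -> in_closure S' X.
Proof. by move=> sub cX e /cX[Y /sub]; exists Y. Qed.

Lemma in_closure_idem n (S : set 'M[C]_n) X :
  in_closure (in_closure S) X -> in_closure S X.
Proof.
move=> cX e e0; have [|Y cY hY] := cX (e / 2); first by rewrite divr_gt0.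
have [|Z SZ hZ] := cY (e / 2); first by rewrite divr_gt0.
exists Z => // i j; rewrite [e]splitr rCD.
apply: le_lt_trans (ltrD (hZ i j) (hY i j)).
by apply: le_trans (ler_normD _ _); rewrite addrA subrK.
Qed.
End Compactness.

(** * The trace pairing on Hermitian matrices and first-order optimality *)

Section Duality.
Variable R : realType.
Local Notation C := R[i].

(* An inner product on Hermitian matrices only: no adjoint is taken. *)
Definition hsdot n (U V : 'M[C]_n) : R := complex.Re (\tr (U *m V)).

Lemma hsdotC n (U V : 'M[C]_n) : hsdot U V = hsdot V U.
Proof. by rewrite /hsdot mxtrace_mulC. Qed.

Lemma hsdotDr n (U V W : 'M[C]_n) : hsdot U (V + W) = hsdot U V + hsdot U W.
Proof. by rewrite /hsdot mulmxDr mxtraceD raddfD. Qed.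

Lemma hsdotNr n (U V : 'M[C]_n) : hsdot U (- V) = - hsdot U V.
Proof. by rewrite /hsdot mulmxN !raddfN. Qed.

Lemma hsdotZr n (U V : 'M[C]_n) (t : R) : hsdot U (rC t *: V) = t * hsdot U V.
Proof.
by rewrite /hsdot -scalemxAr mxtraceZ; case: (\tr _) => a b /=; rewrite mul0r subr0.
Qed.

Lemma hsdotDl n (U V W : 'M[C]_n) : hsdot (V + W) U = hsdot V U + hsdot W U.
Proof. by rewrite hsdotC hsdotDr !(hsdotC U). Qed.

Lemma hsdotNl n (U V : 'M[C]_n) : hsdot (- V) U = - hsdot V U.
Proof. by rewrite hsdotC hsdotNr (hsdotC U). Qed.

Lemma hsdotZl n (U V : 'M[C]_n) (t : R) : hsdot (rC t *: V) U = t * hsdot V U.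
Proof. by rewrite hsdotC hsdotZr (hsdotC U). Qed.

Lemma hsdot_sqB n (U V : 'M[C]_n) :
  hsdot (U - V) (U - V) = hsdot U U - hsdot V U *+ 2 + hsdot V V.
Proof. by rewrite hsdotDl !hsdotDr !hsdotNl !hsdotNr (hsdotC U V); ring. Qed.

Lemma hsdot_sqE n (U : 'M[C]_n) : adj U = U ->
  rC (hsdot U U) = \sum_i \sum_j `|U i j| ^+ 2.
Proof.
move=> hU; have e : \tr (U *m U) = \sum_i \sum_j `|U i j| ^+ 2.
  rewrite -{1}hU trace_mul_entries exchange_big; apply: eq_bigr => i _.
  by apply: eq_bigr => j _; rewrite adjE normCKC.
rewrite /hsdot e rC_Re //; apply: sumr_ge0 => i _; apply: sumr_ge0 => j _.
exact: exprn_ge0.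
Qed.

Lemma hsdot_entry n (U : 'M[C]_n) i j : adj U = U ->
  `|U i j| ^+ 2 <= rC (hsdot U U).
Proof.
move=> hU; rewrite hsdot_sqE // (bigD1 i) //= (bigD1 j) //= -addrA lerDl.
by rewrite addr_ge0 // sumr_ge0 // => k _;
  rewrite ?sumr_ge0 // => *; rewrite exprn_ge0.
Qed.

Lemma hsdot_ge0 n (U : 'M[C]_n) : adj U = U -> 0 <= hsdot U U.
Proof.
move=> hU; rewrite -rC_ge0 hsdot_sqE //.
by apply: sumr_ge0 => i _; apply: sumr_ge0 => j _; rewrite exprn_ge0.
Qed.

Lemma hsdot_eq0 n (U : 'M[C]_n) : adj U = U -> hsdot U U <= 0 -> U = 0.
Proof.
move=> hU h; apply/matrixP => i j; rewrite mxE; apply/eqP.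
rewrite -normr_eq0 -sqrf_eq0 eq_le exprn_ge0 // andbT.
by apply: le_trans (hsdot_entry i j hU) _; rewrite ler_rC.
Qed.

Lemma hsdot_entry_le n (U : 'M[C]_n) i j (H : R) : adj U = U ->
  hsdot U U <= H -> `|U i j| <= rC (H + 1).
Proof.
move=> hU hH; have := hsdot_entry i j hU; rewrite -(rC_Re (normr_ge0 (U i j))).
have := Re_ge0 (normr_ge0 (U i j)); set a := complex.Re _ => a0.
by rewrite expr2 -rCM !ler_rC; nra.
Qed.

Lemma adjD n (A B : 'M[C]_n) : adj (A + B) = adj A + adj B.
Proof. by apply/matrixP => i j; rewrite !(mxE, adjE) rmorphD. Qed.

Lemma adjN n (A : 'M[C]_n) : adj (- A) = - adj A.
Proof. by apply/matrixP => i j; rewrite !(mxE, adjE) rmorphN. Qed.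

Lemma adj_scale_real n (A : 'M[C]_n) (t : R) : adj (rC t *: A) = rC t *: adj A.
Proof.
apply/matrixP => i j; rewrite !(mxE, adjE) rmorphM /=; congr (_ * _).
by rewrite /rC; apply/eqP; rewrite eq_complex /= oppr0 !eqxx.
Qed.

(** Self-duality of the positive cone: rank-one [P] already recover the quadratic form. *)
Lemma psd_of_hsdot n (A : 'M[C]_n) : adj A = A ->
  (forall P, psd P -> 0 <= hsdot A P) -> psd A.
Proof.
move=> hA hP; split=> [i j|v]; first by rewrite -adjE hA.
pose G (_ : unit) i := (v i)^*.
pose P : 'M[C]_n := \matrix_(i, j) \sum_c (G c i)^* * G c j.
have pP : psd P.
  rewrite /psd (_ : (fun i j => _) = fun i j => \sum_c (G c i)^* * G c j).
    exact: psdF_gram.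
  by apply/funext => i; apply/funext => j; rewrite mxE.
have e : \tr (A *m P) = \sum_i \sum_j ((v i)^* * A i j * v j).
  rewrite trace_mul_entries; apply: eq_bigr => i _; apply: eq_bigr => j _.
  rewrite mxE (big_pred1 tt) /G ?conjCK; last by case.
  by ring.
(* [hsdot] only sees the real part, so the trace has to be shown real. *)
have real : (\tr (A *m P))^* = \tr (A *m P).
  rewrite !trace_mul_entries rmorph_sum exchange_big /=.
  apply: eq_bigr => i _; rewrite rmorph_sum /=; apply: eq_bigr => j _.
  by rewrite rmorphM /= -!adjE hA (psd_adj pP).
have := hP _ pP; rewrite -e /hsdot -rC_ge0 => h.
by rewrite -(RRe_real (x := \tr (A *m P))) //; apply/CrealP.
Qed.

Lemma norm_trace_le n (U : 'M[C]_n) (M : R) :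
  (forall i j, `|U i j| <= rC M) -> `|\tr U| <= rC (M *+ n).
Proof.
move=> h; apply: le_trans (ler_norm_sum _ _ _) _.
apply: le_trans (ler_sum _ (fun i _ => h i i)) _.
by rewrite sumr_const card_ord [rC (_ *+ _)](raddfMn (real_complex R)).
Qed.

Lemma family_Re_ge0 (T : finType) n (S : set (T -> 'M[C]_n))
    (x a : T -> 'M[C]_n) (c : R) :
  (forall e : R, 0 < e ->
     exists2 y, S y & forall t i j, `|y t i j - x t i j| < rC e) ->
  (forall y, S y -> 0 <= c + \sum_t hsdot (a t) (y t)) ->
  0 <= c + \sum_t hsdot (a t) (x t).
Proof.
move=> cX h.
have trE (Y : T -> 'M[C]_n) : \sum_t hsdot (a t) (Y t) = complex.Re
    (\sum_(p : T * ('I_n * 'I_n)) a p.1 p.2.2 p.2.1 * Y p.1 p.2.1 p.2.2).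
  rewrite sum_pair raddf_sum /=; apply: eq_bigr => t _; rewrite sum_pair.
  by rewrite /hsdot trace_mul_entries exchange_big.
rewrite trE; apply: (@adherent_Re_ge0 _ _
  [set y | exists2 Y, S Y & y = fun p => Y p.1 p.2.1 p.2.2]).
  move=> e /cX[Y SY hY]; exists (fun p => Y p.1 p.2.1 p.2.2) => //.
  by exists Y.
by move=> y [Y SY ->]; rewrite -trE; apply: h.
Qed.

(** If [b < 0], the linear term dominates at [t = min 1 (- b / (c + 1))]. *)
Lemma first_order_ge0 (b c : R) : 0 <= c ->
  (forall t, 0 < t -> t <= 1 -> 0 <= t * b *+ 2 + t ^+ 2 * c) -> 0 <= b.
Proof.
move=> c0 h; rewrite leNgt; apply/negP => b0.
pose t := Num.min 1 (- b / (c + 1)).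
have c1 : 0 < c + 1 by lra.
have t0 : 0 < t by rewrite lt_min ltr01 divr_gt0 // oppr_gt0.
have t1 : t <= 1 by rewrite ge_min lexx.
have tc : t * (c + 1) <= - b by rewrite -ler_pdivlMr // ge_min lexx orbT.
have : 0 <= t * (b *+ 2 + t * c).
  by have := h t t0 t1; rewrite mulrDr mulrnAr mulrA -expr2.
by rewrite pmulr_rge0 //; nra.
Qed.

(** Here [x] is the gap at the limit, its residuals paired with themselves: [x <= (x + H) / 2] gives
    [x <= H]. *)
Lemma le_of_pairing (x L r s H : R) : x = - L - r + s ->
  0 <= (x + H) / 2 + r - s + L -> x <= H.
Proof. by move=> *; lra. Qed.

(** The two squares give [a + b <= (u + v + H) / 2], stated with the linear term [L] isolated. *)
Lemma polar_ge0 (u v a b p q L r s H : R) : a + b = - L - r + s ->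
  0 <= p - a *+ 2 + u -> 0 <= q - b *+ 2 + v -> p + q <= H ->
  0 <= (u + v + H) / 2 + r - s + L.
Proof. by move=> *; lra. Qed.

Lemma first_order_arith (a b c d e f t : R) :
  a + b <= a + t * c + (t * c + t * (t * d)) + (b - (t * e) *+ 2 + t * (t * f)) ->
  0 <= t * (c - e) *+ 2 + t ^+ 2 * (d + f).
Proof. by move=> *; lra. Qed.

Lemma minimal_gap_arith (G a b c d : R) : 0 < G ->
  G = a - b - c + d -> 0 <= - a - - b -> - d < - c.
Proof. by move=> *; lra. Qed.

Local Notation i0 := (ord0 : 'I_3).
Local Notation i1 := (lift ord0 ord0 : 'I_3).
Local Notation i2 := (lift ord0 (lift ord0 ord0) : 'I_3).

(** * A theorem of the alternative for a closed convex cone of Hermitian matrices *)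

Section Alternative.
Variables (n : nat) (K : set 'M[C]_n) (rho : 'M[C]_n) (g : R).
Hypothesis K_adj : forall X, K X -> adj X = X.
Hypothesis K0 : K 0.
Hypothesis KD : forall X Y, K X -> K Y -> K (X + Y).
Hypothesis KZ : forall (t : R) X, 0 <= t -> K X -> K (rC t *: X).
Hypothesis K_closed : closed_set K.
Hypothesis rho_density : density rho.

(* [y] collects the unknown [S] and the slacks [P], [Q] of
   [S - P = rho], [S + Q = g rho]. *)
Definition slacks (y : 'I_3 -> 'M[C]_n) : Prop :=
  [/\ K (y i0), psd (y i1) & psd (y i2)].

Definition lower_gap (y : 'I_3 -> 'M[C]_n) : 'M[C]_n := y i0 - y i1 - rho.
Definition upper_gap (y : 'I_3 -> 'M[C]_n) : 'M[C]_n := rC g *: rho - y i0 - y i2.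

Definition gap (y : 'I_3 -> 'M[C]_n) : R :=
  hsdot (lower_gap y) (lower_gap y) + hsdot (upper_gap y) (upper_gap y).

Lemma lower_gap_adj y : slacks y -> adj (lower_gap y) = lower_gap y.
Proof.
move=> [/K_adj e /psd_adj e1 _]; rewrite !(adjD, adjN) e e1.
by rewrite (psd_adj (proj1 rho_density)).
Qed.

Lemma upper_gap_adj y : slacks y -> adj (upper_gap y) = upper_gap y.
Proof.
move=> [/K_adj e _ /psd_adj e2]; rewrite !(adjD, adjN) adj_scale_real e e2.
by rewrite (psd_adj (proj1 rho_density)).
Qed.

Lemma gap_ge0 y : slacks y -> 0 <= gap y.
Proof.
by move=> Dy; rewrite addr_ge0 // hsdot_ge0 ?lower_gap_adj ?upper_gap_adj.
Qed.

(** [S] cancels in the sum of the residuals, which is [(g - 1) rho - P - Q]. Its trace bounds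
    [tr P + tr Q], hence the entries of both slacks, and [S] is recovered from the lower
    residual. *)
Lemma slacks_bounded (H : R) : exists M : R,
  forall y, slacks y -> gap y <= H -> forall t i j, `|y t i j| <= rC M.
Proof.
(* Each [(H + 1) *+ n] bounds the trace of one residual. In the total below, [H + 1], [N] and [1]
   bound the entries of the lower residual, of [P] and of [rho]. *)
pose N := `|g - 1| + (H + 1) *+ n + (H + 1) *+ n.
exists (H + 1 + N + 1) => y Dy hy.
have hU : hsdot (lower_gap y) (lower_gap y) <= H.
  by apply: le_trans hy; rewrite lerDl hsdot_ge0 ?upper_gap_adj.
have hV : hsdot (upper_gap y) (upper_gap y) <= H.
  by apply: le_trans hy; rewrite lerDr hsdot_ge0 ?lower_gap_adj.
have H0 : 0 <= H by apply: le_trans hU; rewrite hsdot_ge0 ?lower_gap_adj.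
have eU i j := hsdot_entry_le i j (lower_gap_adj Dy) hU.
have eV i j := hsdot_entry_le i j (upper_gap_adj Dy) hV.
case: (Dy) => _ p1 p2.
have t1 := psd_trace_ge0 p1; have t2 := psd_trace_ge0 p2.
have N0 : 0 <= N by rewrite !addr_ge0 // mulrn_wge0 // addr_ge0.
have tN : \tr (y i1) + \tr (y i2) <= rC N.
  have e : \tr (y i1) + \tr (y i2) =
      rC (g - 1) - \tr (lower_gap y) - \tr (upper_gap y).
    rewrite /lower_gap /upper_gap !raddfB /= mxtraceZ (proj2 rho_density).
    rewrite rCD rCN rC1; ring.
  rewrite -(ger0_norm (addr_ge0 t1 t2)) e (rCD (`|g - 1| + _)) (rCD `|g - 1|).
  apply: le_trans (ler_normB _ _) _; apply: lerD; last exact: norm_trace_le.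
  apply: le_trans (ler_normB _ _) _; apply: lerD; last exact: norm_trace_le.
  apply: le_trans (norm_le_ReIm _) _.
  by rewrite ler_rC /= normr0 addr0.
have b1 i j : `|y i1 i j| <= rC N.
  by apply: le_trans (psd_entry_le i j p1) _; apply: le_trans tN; rewrite lerDl.
have b2 i j : `|y i2 i j| <= rC N.
  by apply: le_trans (psd_entry_le i j p2) _; apply: le_trans tN; rewrite lerDr.
have b0 i j : `|y i0 i j| <= rC (H + 1 + N + 1).
  have -> : y i0 i j = lower_gap y i j + y i1 i j + rho i j.
    by rewrite !mxE; ring.
  rewrite (rCD (H + 1 + N)) (rCD (H + 1)).
  apply: le_trans (ler_normD _ _) _; apply: lerD.
    by apply: le_trans (ler_normD _ _) _; apply: lerD.
  by rewrite rC1 -(proj2 rho_density) psd_entry_le //; case: rho_density.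
have wk i j (z : 'M[C]_n) : `|z i j| <= rC N -> `|z i j| <= rC (H + 1 + N + 1).
  by move=> /le_trans; apply; rewrite ler_rC; lra.
move=> t i j; case: (unliftP ord0 t) => [t'|] ->; last exact: b0.
apply: wk; case: (unliftP ord0 t') => [t''|] ->; last exact: b1.
by rewrite (ord1 t''); apply: b2.
Qed.

(** All dependence on [y] sits in one real-linear term, so it can be followed to a limit or along a
    direction. *)
Lemma gap_pairing (U V : 'M[C]_n) y :
  hsdot U (lower_gap y) + hsdot V (upper_gap y) =
   - (hsdot (V - U) (y i0) + (hsdot U (y i1) + hsdot V (y i2)))
   - hsdot U rho + g * hsdot V rho.
Proof.
rewrite /lower_gap /upper_gap; move: (y i0) (y i1) (y i2) => S P Q.
rewrite !hsdotDr !hsdotNr hsdotZr hsdotDl hsdotNl.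
move: (hsdot U S) (hsdot V S) (hsdot U P) (hsdot V Q) (hsdot U rho) (hsdot V rho).
by move=> *; ring.
Qed.

Lemma gap_minimizer : exists2 x, slacks x & forall y, slacks y -> gap x <= gap y.
Proof.
pose E := [set gap y | y in slacks].
have D0 : slacks (fun=> 0) by split=> //; exact: psd0.
have E0 : has_lbound E by exists 0 => _ [y Dy <-]; exact: gap_ge0.
have iE : has_inf E by split=> //; exists (gap (fun=> 0)); exists (fun=> 0).
pose h0 := inf E.
have h0_le y : slacks y -> h0 <= gap y by move=> Dy; apply: ge_inf => //; exists y.
have [M hM] := slacks_bounded (h0 + 1).
(* The cap [h0 + 1] keeps the family bounded uniformly, even for large [d]. *)
have [] := @family_cluster R 'I_3 n
   (fun d => [set y | [/\ slacks y, gap y <= h0 + d & gap y <= h0 + 1]]) M.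
- move=> d d' dd' y [Dy h1 h2]; split=> //.
  by apply: le_trans h1 _; rewrite lerD2l.
- move=> d d0; have [|_ [y Dy <-] hy] := @inf_adherent _ E (Num.min d 1) _ iE.
    by rewrite lt_min d0 ltr01.
  by exists y; split=> //; apply: ltW; apply: lt_le_trans hy _;
    rewrite lerD2l ge_min lexx ?orbT.
- by move=> d y d0 [Dy _ h2]; apply: hM.
move=> x hx.
have Dx : slacks x.
  split.
  - by apply: K_closed => e e0; have [y [[]]] := hx 1 e ltr01 e0; exists (y i0).
  - apply: (@psd_closure _ _ (@psd R n)) => // e e0.
    by have [y [[]]] := hx 1 e ltr01 e0; exists (y i1).
  - apply: (@psd_closure _ _ (@psd R n)) => // e e0.
    by have [y [[]]] := hx 1 e ltr01 e0; exists (y i2).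
exists x => // y Dy; apply: le_trans (h0_le _ Dy).
(* The gap is quadratic; [2 <U, U_y> <= |U|^2 + |U_y|^2] makes the passage to the
   limit linear in [y]. *)
apply/ler_addgt0Pr => d d0.
pose U := lower_gap x; pose V := upper_gap x.
pose a (t : 'I_3) : 'M[C]_n :=
  if t == i0 then V - U else if t == i1 then U else V.
have sumE (z : 'I_3 -> 'M[C]_n) : \sum_t hsdot (a t) (z t) =
    hsdot (V - U) (z i0) + (hsdot U (z i1) + hsdot V (z i2)).
  by rewrite !big_ord_recl big_ord0 addr0.
have := @family_Re_ge0 _ n [set y | slacks y /\ gap y <= h0 + d] x a
  ((gap x + (h0 + d)) / 2 + hsdot U rho - g * hsdot V rho).
rewrite !sumE.
have gx := gap_pairing U V x; rewrite -/U -/V -/(gap x) in gx.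
move=> h; apply: (le_of_pairing gx); apply: h.
  by move=> e e0; have [z []] := hx d e d0 e0; exists z.
move=> z [Dz hz]; rewrite sumE.
have hU : 0 <= hsdot (lower_gap z - U) (lower_gap z - U).
  by rewrite hsdot_ge0 // adjD adjN !lower_gap_adj.
have hV : 0 <= hsdot (upper_gap z - V) (upper_gap z - V).
  by rewrite hsdot_ge0 // adjD adjN !upper_gap_adj.
rewrite hsdot_sqB in hU; rewrite hsdot_sqB in hV.
exact: (polar_ge0 (gap_pairing U V z) hU hV hz).
Qed.

(** A vanishing minimal gap solves both equations. Otherwise [A] and [B] are the negated residuals,
    and the four conclusions are optimality when moving [P], [Q] or [S], or shrinking all three. *)
Lemma cone_alternative :
  (exists S, [/\ K S, psd (S - rho) & psd (rC g *: rho - S)]) \/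
  (exists A B, [/\ psd A, psd B, forall S, K S -> hsdot A S <= hsdot B S &
                   g * hsdot B rho < hsdot A rho]).
Proof.
have [x Dx xmin] := gap_minimizer.
case: (Dx) => Kx p1 p2.
have aU := lower_gap_adj Dx; have aV := upper_gap_adj Dx.
have [le0|gt0] := leP (gap x) 0; [left|right].
  have U0 : lower_gap x = 0.
    apply: hsdot_eq0 => //; apply: le_trans le0.
    by rewrite lerDl hsdot_ge0.
  have V0 : upper_gap x = 0.
    apply: hsdot_eq0 => //; apply: le_trans le0.
    by rewrite lerDr hsdot_ge0.
  exists (x i0); split=> //.
    rewrite (_ : _ - _ = x i1) //; apply/eqP; rewrite -subr_eq0 -U0.
    by rewrite /lower_gap addrAC.
  rewrite (_ : _ - _ = x i2) //; apply/eqP; rewrite -subr_eq0 -V0.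
  by rewrite /upper_gap.
(* Half the one-sided derivative of the gap at its minimiser, along an admissible direction [z]. *)
have vary (z : 'I_3 -> 'M[C]_n) : adj (z i0) = z i0 -> adj (z i1) = z i1 ->
    adj (z i2) = z i2 ->
    (forall t : R, 0 < t -> t <= 1 -> slacks (fun k => x k + rC t *: z k)) ->
    0 <= hsdot (lower_gap x) (z i0 - z i1) - hsdot (upper_gap x) (z i0 + z i2).
  move=> a0 a1 a2 hz.
  have lg t : lower_gap (fun k => x k + rC t *: z k) =
      lower_gap x + rC t *: (z i0 - z i1).
    by apply/matrixP => i j; rewrite !mxE; ring.
  have ug t : upper_gap (fun k => x k + rC t *: z k) =
      upper_gap x - rC t *: (z i0 + z i2).
    by apply/matrixP => i j; rewrite !mxE; ring.
  pose u := z i0 - z i1; pose v := z i0 + z i2.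
  have au : adj u = u by rewrite adjD adjN a0 a1.
  have av : adj v = v by rewrite adjD a0 a2.
  apply: (@first_order_ge0 _ (hsdot u u + hsdot v v)).
    by rewrite addr_ge0 // hsdot_ge0.
  move=> t t0 t1; have := xmin _ (hz t t0 t1).
  rewrite /gap lg ug -/u -/v.
  move: (lower_gap x) (upper_gap x) u v au av => U V u v _ _.
  rewrite hsdot_sqB hsdotDl !hsdotDr !hsdotZl !hsdotZr (hsdotC u U) (hsdotC v V).
  exact: first_order_arith.
exists (- lower_gap x), (- upper_gap x).
have zero_adj : adj (0 : 'M[C]_n) = 0 by rewrite (psd_adj (psd0 _ n)).
split.
- apply: psd_of_hsdot => [|P pP]; first by rewrite adjN aU.
  have := vary (fun k => if k == i1 then P else 0).
  rewrite /= sub0r addr0 hsdotNr hsdotNl /hsdot mulmx0 mxtrace0 subr0; apply => //.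
    exact: psd_adj.
  move=> t t0 _; split; rewrite /= ?scaler0 ?addr0 //.
  by apply: psdD => //; apply: psdZ => //; rewrite rC_ge0 ltW.
- apply: psd_of_hsdot => [|P pP]; first by rewrite adjN aV.
  have := vary (fun k => if k == i2 then P else 0).
  rewrite /= subr0 add0r hsdotNl /hsdot mulmx0 mxtrace0 sub0r; apply => //.
    exact: psd_adj.
  move=> t t0 _; split; rewrite /= ?scaler0 ?addr0 //.
  by apply: psdD => //; apply: psdZ => //; rewrite rC_ge0 ltW.
- move=> S KS.
  have := vary (fun k => if k == i0 then S else 0).
  rewrite /= subr0 addr0 !hsdotNl subr_ge0 lerN2; apply => //.
    exact: K_adj.
  move=> t t0 _; split; rewrite /= ?scaler0 ?addr0 //.
  by apply: KD => //; apply: KZ => //; rewrite ltW.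
(* This direction rescales [x] by [1 - t], which needs [t <= 1]. It makes the pairing of the
   residuals with [x] nonpositive, so the positive gap must come from the [rho] terms. *)
have := vary (fun k => - x k).
have -> : - x i0 - - x i1 = - (x i0 - x i1) by rewrite opprB opprK addrC.
rewrite -opprD !hsdotNr !hsdotNl mulrN => /(_ _ _ _ _) h.
have : 0 <= - hsdot (lower_gap x) (x i0 - x i1)
            - - hsdot (upper_gap x) (x i0 + x i2).
  apply: h.
  - by rewrite adjN K_adj.
  - by rewrite adjN psd_adj.
  - by rewrite adjN psd_adj.
  move=> t t0 t1.
  have e k : x k + rC t *: - x k = rC (1 - t) *: x k.
    by rewrite rCD rCN rC1 scalerBl scale1r scalerN.
  have t1' : 0 <= 1 - t by rewrite subr_ge0.
  by split; rewrite e; [exact: KZ | apply: psdZ | apply: psdZ] => //; rewrite rC_ge0.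
have : gap x = hsdot (lower_gap x) (x i0 - x i1) - hsdot (upper_gap x) (x i0 + x i2)
  - hsdot (lower_gap x) rho + g * hsdot (upper_gap x) rho.
  rewrite /gap gap_pairing.
  move: (lower_gap x) (upper_gap x) (x i0) (x i1) (x i2) => U V S P Q.
  by rewrite hsdotDl hsdotNl !hsdotDr hsdotNr; ring.
exact: minimal_gap_arith.
Qed.
End Alternative.
End Duality.

(** * The cone of free states and the dual description of [OmegaF] *)

Section Cones.
Variable R : realType.
Local Notation C := R[i].

Lemma density_entry_le n (s : 'M[C]_n) i j : density s -> `|s i j| <= 1.
Proof. by move=> [ps <-]; apply: psd_entry_le. Qed.

Section FreeCone.
Variables (n : nat) (F : set 'M[C]_n).
Hypothesis freeF : free_set F.

Lemma free_density s : F s -> density s.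
Proof. by case: freeF => h _ _ _; apply: h. Qed.

Lemma cone_psd X : cone F X -> psd X.
Proof.
by move=> [l l0 [s /free_density[ps _] ->]]; apply: psdZ => //; rewrite rC_ge0.
Qed.

Lemma cone0 : cone F 0.
Proof.
by case: freeF => _ _ _ [s Fs]; exists 0 => //; exists s; rewrite ?(scale0r s).
Qed.

Lemma coneZ (t : R) X : 0 <= t -> cone F X -> cone F (rC t *: X).
Proof.
move=> t0 [l l0 [s Fs ->]]; exists (t * l); first exact: mulr_ge0.
by exists s => //; rewrite scalerA rCM.
Qed.

Lemma coneD X Y : cone F X -> cone F Y -> cone F (X + Y).
Proof.
move=> [l l0 [s Fs ->]] [k k0 [t Ft ->]].
have [lk|lk] := leP (l + k) 0.
  have -> : l = 0 by lra.
  have -> : k = 0 by lra.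
  by rewrite rC0 !scale0r addr0; exact: cone0.
have lk0 : l + k != 0 by rewrite gt_eqF.
exists (l + k); first exact: ltW.
exists (rC (l / (l + k)) *: s + rC (1 - l / (l + k)) *: t).
  case: freeF => _ cvx _ _; apply: cvx => //.
  by rewrite (divr_ge0 l0 (ltW lk)) /= ler_pdivrMr // mul1r lerDl.
rewrite scalerDr !scalerA -!rCM; congr (rC _ *: _ + rC _ *: _); by field.
Qed.

(** The scale of a cone element is its trace. A limit of trace zero is [0]; otherwise dividing by
    the trace gives a limit of free states. *)
Lemma cone_closed : closed_set (cone F).
Proof.
move=> X cX.
have pX : psd X by apply: (psd_closure cX) => Y; exact: cone_psd.
pose l := complex.Re (\tr X).
have l0 : 0 <= l by apply/Re_ge0/psd_trace_ge0.
have trX : \tr X = rC l by rewrite rC_Re // psd_trace_ge0.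
move: l0; rewrite le_eqVlt => /predU1P[l0|l0].
  by rewrite (psd_trace0 pX) ?trX -?l0 //; exact: cone0.
have rl0 : rC l != 0 by rewrite gt_eqF // -rC0 ltr_rC.
exists l; first exact: ltW.
exists ((rC l)^-1 *: X); last by rewrite scalerA divff // scale1r.
case: freeF => _ _ closedF _; apply: closedF => e e0.
(* The error [e * l] is split into [n + 1] shares: one for the entry and [n] for the trace
   difference. *)
pose e' := e * l / n.+1%:R.
have e'0 : 0 < e' by rewrite divr_gt0 ?mulr_gt0.
have [Y [k k0 [s Fs eY]] hY] := cX e' e'0; subst Y.
have ds := free_density Fs.
exists s => // i j; rewrite mxE.
have kl : `|rC k - rC l| <= rC (e' *+ n).
  have -> : rC k - rC l = \tr (rC k *: s - X).
    by rewrite raddfB /= mxtraceZ (proj2 ds) mulr1 trX.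
  by apply: norm_trace_le => a b; rewrite mxE [X in _ + X]mxE ltW.
have -> : s i j - (rC l)^-1 * X i j =
   (rC l)^-1 * ((rC k * s i j - X i j) - (rC k - rC l) * s i j) by field.
rewrite normrM normfV (_ : `|rC l| = rC l); last first.
  by rewrite ger0_norm // rC_ge0 ltW.
rewrite mulrC ltr_pdivrMr; last by rewrite -rC0 ltr_rC.
apply: le_lt_trans (ler_normB _ _) _.
have -> : rC e * rC l = rC e' + rC (e' *+ n).
  by rewrite -rCM -rCD -mulrS -mulr_natr divfK // pnatr_eq0.
apply: ltr_leD; first by have := hY i j; rewrite mxE.
rewrite normrM -[leRHS]mulr1; apply: ler_pM => //.
exact: density_entry_le.
Qed.
End FreeCone.

Lemma density_le_scale n (X Y : 'M[C]_n) (l : R) :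
  density X -> density Y -> loewner X (rC l *: Y) -> 1 <= l.
Proof.
move=> [_ tX] [_ tY] /psd_trace_ge0.
by rewrite raddfB /= mxtraceZ tX tY mulr1 subr_ge0 -rC1 ler_rC.
Qed.

Lemma Rmax_ge1 n (X Y : 'M[C]_n) : density X -> density Y -> (1%:E <= Rmax X Y)%E.
Proof.
move=> dX dY; apply: le_ereal_inf_tmp => _ [l /= h <-].
by rewrite lee_fin; apply: density_le_scale dX dY h.
Qed.

Lemma OmegaF_ge1 n (F : set 'M[C]_n) rho : free_set F -> density rho ->
  (1%:E <= OmegaF F rho)%E.
Proof.
move=> fF drho; apply: le_ereal_inf_tmp => _ [s Fs <-].
have ds := free_density fF Fs.
by rewrite -[X in (X <= _)%E]mule1 lee_pmul ?Rmax_ge1.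
Qed.

(** The two factors of the product at [s] are at most [l] and [g / l]. *)
Lemma OmegaF_le n (F : set 'M[C]_n) rho s (l g : R) :
  free_set F -> density rho -> F s -> psd (rC l *: s - rho) ->
  psd (rC g *: rho - rC l *: s) -> (OmegaF F rho <= g%:E)%E.
Proof.
move=> fF drho Fs p1 p2; have ds := free_density fF Fs.
have l1 : 1 <= l by apply: density_le_scale drho ds p1.
have l0 : 0 < l by apply: lt_le_trans l1.
have lN0 : l != 0 by rewrite gt_eqF.
have b1 : (Rmax rho s <= l%:E)%E by apply: ereal_inf_lbound; exists l.
have b2 : (Rmax s rho <= (g / l)%:E)%E.
  apply: ereal_inf_lbound; exists (g / l) => //=.
  rewrite /loewner (_ : _ - _ = rC l^-1 *: (rC g *: rho - rC l *: s)).
    by apply: psdZ => //; rewrite rC_ge0 invr_ge0 ltW.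
  rewrite scalerBr !scalerA -!rCM mulVf // rC1 scale1r; congr (rC _ *: _ - _).
  by rewrite mulrC.
have := @ereal_inf_lbound _ [set (Rmax rho s * Rmax s rho)%E | s in F].
move=> /(_ _ (ex_intro2 _ _ s Fs erefl)) /le_trans; apply.
have -> : g%:E = (l%:E * (g / l)%:E)%E.
  by rewrite -EFinM; congr EFin; field.
have ge0 X Y : density X -> density Y -> (0%:E <= Rmax X Y :> \bar R)%E.
  by move=> dX dY; apply: le_trans (Rmax_ge1 dX dY); rewrite lee_fin.
by apply: lee_pmul => //; apply: ge0.
Qed.

Lemma OmegaF_dual n (F : set 'M[C]_n) rho (g : R) :
  free_set F -> density rho -> (g%:E < OmegaF F rho)%E ->
  exists A B, [/\ psd A, psd B, forall s, F s -> hsdot A s <= hsdot B s &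
                  g * hsdot B rho < hsdot A rho].
Proof.
move=> fF drho gO.
have [|[A [B [pA pB h ?]]]] := @cone_alternative R n (cone F) rho g
  (fun X h => psd_adj (cone_psd fF h)) (cone0 fF) (@coneD _ _ fF) (@coneZ _ F)
  (cone_closed fF) drho.
  move=> [_ [[l l0 [s Fs ->]] p1 p2]].
  by have := OmegaF_le fF drho Fs p1 p2; rewrite leNgt gO.
exists A, B; split=> // s Fs; apply: h; exists 1 => //.
by exists s; rewrite ?rC1 ?scale1r.
Qed.

(** * The real span of the free states and the affine case of the dual description *)

Section Span.
Variables (n : nat) (F : set 'M[C]_n).
Hypothesis densityF : forall s, F s -> density s.

Definition stack k (s : 'I_k -> 'M[C]_n) : 'M[C]_(k, n * n) :=
  \matrix_i mxvec (s i).

(* A family of maximal rank spans. *)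
Lemma free_spanning_family : exists k (s : 'I_k -> 'M[C]_n),
  (forall i, F (s i)) /\ forall X, F X -> (mxvec X <= stack s)%MS.
Proof.
pose attained r := `[< exists k (s : 'I_k -> 'M[C]_n),
  (forall i, F (s i)) /\ \rank (stack s) = r >].
have ex : exists r, attained r.
  pose s0 (i : 'I_0) : 'M[C]_n := 0.
  by exists (\rank (stack s0)); apply/asboolP; exists 0%N, s0; split=> // -[].
have ub r : attained r -> (r <= n * n)%N.
  by move=> /asboolP[k [s [_ <-]]]; apply: rank_leq_col.
case: (ex_maxnP ex ub) => r /asboolP[k [s [Fs rs]]] rmax.
exists k, s; split=> // X FX; apply/negPn/negP => nX.
pose s' (i : 'I_k.+1) := oapp s X (unlift ord0 i).
have sub : (stack s <= stack s')%MS.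
  apply/row_subP => i; rewrite rowK.
  have -> : mxvec (s i) = row (lift ord0 i) (stack s') by rewrite rowK /s' liftK.
  exact: row_sub.
have subX : (mxvec X <= stack s')%MS.
  have -> : mxvec X = row ord0 (stack s') by rewrite rowK /s' unlift_none.
  exact: row_sub.
have : (\rank (stack s) < \rank (stack s'))%N.
  apply: rank_ltmx; rewrite ltmxE sub /=; apply/negP => h.
  by move: nX; rewrite (submx_trans subX h).
rewrite ltnNge rs rmax //; apply/asboolP; exists k.+1, s'; split=> // i.
by rewrite /s'; case: unliftP => [j|] _ /=.
Qed.

Variables (k : nat) (s : 'I_k -> 'M[C]_n).
Hypothesis Fs : forall i, F (s i).

(* A complex combination of Hermitian matrices that is Hermitian is a real one,
   so the complex row space suffices. *)
Definition real_span : set 'M[C]_n :=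
  [set X | adj X = X /\ (mxvec X <= stack s)%MS].

Lemma real_span_closed : closed_set real_span.
Proof.
move=> X cX; split; first by apply: (adj_closure cX) => Y [].
rewrite submxE; apply/eqP/rowP => q; rewrite [RHS]mxE.
(* Membership in the row space is a system of linear equations; column [q] of the cokernel is
   rewritten as a trace functional. *)
pose a : 'M[C]_n := \matrix_(j, i) cokermx (stack s) (mxvec_index i j) q.
have e (Y : 'M[C]_n) : (mxvec Y *m cokermx (stack s)) 0 q = \tr (a *m Y).
  rewrite mxE (reindex _ (curry_mxvec_bij _ _)) /= trace_mul_entries exchange_big.
  rewrite pair_bigA; apply: eq_bigr => -[i j] _ /=.
  by rewrite mxvecE !mxE mulrC.
rewrite e; apply: (closure_eq cX) => Y [_].
by rewrite submxE -e => /eqP ->; rewrite mxE.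
Qed.

Lemma real_span_comb X : real_span X ->
  exists c : 'I_k -> R, X = \sum_i rC (c i) *: s i.
Proof.
move=> [aX /submxP[D eD]].
have XD : X = \sum_i D 0 i *: s i.
  rewrite -[X]mxvecK eD mulmx_sum_row linear_sum /=; apply: eq_bigr => i _.
  by rewrite linearZ /= rowK mxvecK.
(* Adjoints conjugate the coefficients; averaging both expansions leaves their real parts. *)
have XDc : X = \sum_i (D 0 i)^* *: s i.
  rewrite -aX {1}XD; apply/matrixP => i j; rewrite adjE !summxE rmorph_sum /=.
  apply: eq_bigr => l _; rewrite !mxE rmorphM /= -adjE.
  by rewrite (psd_adj (proj1 (densityF (Fs l)))).
exists (fun i => complex.Re (D 0 i)).
apply: (@scalerI _ _ (2%:R : C)); first by rewrite pnatr_eq0.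
rewrite scaler_nat mulr2n {1}XD XDc -big_split scaler_sumr /=.
apply: eq_bigr => i _; rewrite -scalerDl scalerA; congr (_ *: _).
by have := addcJ (D 0 i).
Qed.
End Span.

(** An [S] in the span with [rho <= S <= g rho] is positive of trace at least [1], so its
    normalisation is an affine combination that is a state, hence free; this contradicts
    [g < OmegaF F rho]. *)
Lemma OmegaF_dual_affine n (F : set 'M[C]_n) rho (g : R) :
  free_set F -> affine_set F -> density rho -> (g%:E < OmegaF F rho)%E ->
  exists A B, [/\ psd A, psd B, forall s, F s -> hsdot A s = hsdot B s &
                  g * hsdot B rho < hsdot A rho].
Proof.
move=> fF aF drho gO.
have [k [s [Fs spanF]]] := free_spanning_family F.
have K0 : real_span s 0.
  by split; [rewrite (psd_adj (psd0 _ _)) | rewrite linear0 sub0mx].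
have KD X Y : real_span s X -> real_span s Y -> real_span s (X + Y).
  by move=> [aX sX] [aY sY]; split; rewrite ?adjD ?aX ?aY // linearD addmx_sub.
have KN X : real_span s X -> real_span s (- X).
  by move=> [aX sX]; split; rewrite ?adjN ?aX // linearN /= eqmx_opp.
have KZ (t : R) X : 0 <= t -> real_span s X -> real_span s (rC t *: X).
  move=> _ [aX sX]; split; first by rewrite adj_scale_real aX.
  have -> : mxvec (rC t *: X) = rC t *: mxvec X by exact: linearZ.
  exact: scalemx_sub.
have [|[A [B [pA pB h ?]]]] := @cone_alternative R n (real_span s) rho g
  (fun X h => proj1 h) K0 KD KZ (@real_span_closed _ _ s) drho.
  move=> [S [KS p1 p2]].
  have [c eS] := real_span_comb (free_density fF) Fs KS.
  pose l := \sum_i c i.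
  have trS : \tr S = rC l.
    rewrite eS raddf_sum rC_sum; apply: eq_bigr => i _ /=.
    by rewrite mxtraceZ (proj2 (free_density fF (Fs i))) mulr1.
  have l1 : 1 <= l.
    have := psd_trace_ge0 p1; rewrite raddfB /= trS (proj2 drho) subr_ge0.
    by rewrite -rC1 ler_rC.
  have l0 : 0 < l by apply: lt_le_trans l1.
  have lN0 : l != 0 by rewrite gt_eqF.
  pose t : 'M[C]_n := \sum_i rC (c i / l) *: s i.
  have St : S = rC l *: t.
    rewrite eS scaler_sumr; apply: eq_bigr => i _.
    by rewrite scalerA -rCM mulrC divfK.
  have pS : psd S by rewrite -[S](subrK rho); apply: psdD => //; case: drho.
  have tS : t = rC l^-1 *: S by rewrite St scalerA -rCM mulVf // scale1r.
  have dt : density t.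
    split; first by rewrite tS; apply: psdZ => //; rewrite rC_ge0 invr_ge0 ltW.
    by rewrite tS mxtraceZ trS -rCM mulVf.
  have Ft : F t.
    by apply: aF => //; rewrite -mulr_suml divff.
  rewrite St in p1 p2.
  by have := OmegaF_le fF drho Ft p1 p2; rewrite leNgt gO.
exists A, B; split=> // X FX.
have KX : real_span s X.
  by split; [apply: psd_adj; case: (free_density fF FX) | exact: spanF].
(* The span contains [- X], where the same inequality reads in reverse. *)
apply/eqP; rewrite eq_le h //=.
by have := h _ (KN _ KX); rewrite !hsdotNr lerN2.
Qed.

End Cones.

(** * Normalised outputs, limits of states, and the threshold *)

Section Achievability.
Variable R : realType.
Local Notation C := R[i].

Lemma trace_hsdot n (A B : 'M[C]_n) : psd A -> psd B ->
  \tr (A *m B) = rC (hsdot A B).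
Proof. by move=> pA pB; rewrite /hsdot rC_Re // psd_trace_mul_ge0. Qed.

Lemma hsdot_psd_ge0 n (A B : 'M[C]_n) : psd A -> psd B -> 0 <= hsdot A B.
Proof. by move=> pA pB; apply/Re_ge0/psd_trace_mul_ge0. Qed.

(** Even without the overlap [o] of the admixture, clearing denominators leaves only [g * b < a]. *)
Lemma overlap_arith (a b g k o : R) : 0 < a + b * k -> 0 <= b -> 0 < g ->
  0 < k -> 0 <= o -> g * b < a ->
  g / (g + k) <= (a + b * k)^-1 * (a * 1 + b * (k * o)).
Proof.
move=> ak0 b0 g0 k0 o0 gb.
rewrite [leRHS]mulrC ler_pdivlMr // mulrAC ler_pdivrMr ?addr_gt0 //.
have h1 : 0 <= (a - g * b) * k by rewrite mulr_ge0 ?subr_ge0 // ltW.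
have h2 : 0 <= b * (k * o) * (g + k).
  by rewrite !mulr_ge0 // ?addr_ge0 // ltW.
lra.
Qed.

Section Fixed.
Variables (n m : nat) (F : set 'M[C]_n) (F' : set 'M[C]_m).
Variables (rho : 'M[C]_n) (phi : 'M[C]_m).
Hypotheses (freeF : free_set F) (freeF' : free_set F').
Hypotheses (drho : density rho) (pure_phi : pure phi).

(** The constant that makes the map trace non-increasing cancels upon normalising the output. *)
Lemma measure_prepare_trans (A B : 'M[C]_n) (P W : 'M[C]_m) :
  psd A -> psd B -> psd P -> psd W ->
  (forall s, F s -> cone F' (\tr (A *m s) *: P + \tr (B *m s) *: W)) ->
  let Y := \tr (A *m rho) *: P + \tr (B *m rho) *: W in
  0 < \tr Y ->
  density ((\tr Y)^-1 *: Y) /\ prob_trans F F' rho ((\tr Y)^-1 *: Y).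
Proof.
move=> pA pB pP pW free Y tY; split.
  split; last by rewrite mxtraceZ mulVf // gt_eqF.
  apply: psdZ; first by rewrite invr_ge0 ltW.
  by apply: psdD; apply: psdZ => //; apply: psd_trace_mul_ge0 => //; case: drho.
have [c c0 fop] := measure_prepare_free_op pA pB pP pW
  (@free_density _ _ _ freeF) (@free_density _ _ _ freeF') free.
have rc0 : 0 < rC c by rewrite -rC0 ltr_rC.
move=> e e0; exists ((\tr Y)^-1 *: Y); last first.
  by move=> i j; rewrite subrr normr0 -rC0 ltr_rC.
exists (fun X => rC c *: (\tr (A *m X) *: P + \tr (B *m X) *: W)).
  by split=> //=; rewrite mxtraceZ mulr_gt0.
rewrite -/Y mxtraceZ scalerA; congr (_ *: _).
by rewrite invfM mulrAC mulVf ?mul1r // gt_eqF.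
Qed.

(** Discarding the input and preparing a free state covers errors of at least [1]. *)
Lemma trans_exists : exists tau, density tau /\ prob_trans F F' rho tau.
Proof.
have [_ _ _ [s' Fs']] := freeF'; have [ps' ts'] := free_density freeF' Fs'.
have p1 : psd (1%:M : 'M[C]_n).
  rewrite /psd (_ : (fun i j => _) =
      fun i j => \sum_c ((c == i)%:R)^* * (c == j)%:R).
    exact: psdF_gram.
  apply/funext => i; apply/funext => j; rewrite (bigD1 i) //= big1 => [|c /negPf ->].
    by rewrite eqxx conjC1 mul1r addr0 mxE.
  by rewrite conjC0 mul0r.
have [||tau dtau] := @measure_prepare_trans _ _ _ _ p1 (psd0 _ _) ps' (psd0 _ _).
- move=> s /(free_density freeF)[_ ts]; rewrite mul1mx ts scale1r scaler0 addr0.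
  by exists 1 => //; exists s'; rewrite ?rC1 ?scale1r.
- by rewrite mul1mx (proj2 drho) scale1r scaler0 addr0 ts' ltr01.
by eexists; split; [exact: tau | exact: dtau].
Qed.

(** Common to both cases, which differ in how the cone condition is met. *)
Lemma achievable_overlap (A B : 'M[C]_n) (omega : 'M[C]_m) (g k : R) :
  psd A -> psd B -> density omega -> 0 < g -> 0 < k ->
  g * hsdot B rho < hsdot A rho ->
  (forall s, F s ->
     cone F' (rC (hsdot A s) *: phi + rC (hsdot B s) *: (rC k *: omega))) ->
  exists tau, [/\ density tau, prob_trans F F' rho tau &
                  g / (g + k) <= hsdot phi tau].
Proof.
move=> pA pB domega g0 k0 gAB free.
have [pphi tphi] := proj1 pure_phi; have [pomega tomega] := domega.
have prho := proj1 drho.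
have pW : psd (rC k *: omega) by apply: psdZ => //; rewrite rC_ge0 ltW.
pose a := hsdot A rho; pose b := hsdot B rho.
have b0 : 0 <= b by apply: hsdot_psd_ge0.
have a0 : 0 < a by apply: le_lt_trans gAB; apply: mulr_ge0 b0; apply: ltW.
have ak0 : 0 < a + b * k by rewrite ltr_pwDl // mulr_ge0 // ltW.
have trY : \tr (\tr (A *m rho) *: phi + \tr (B *m rho) *: (rC k *: omega)) =
    rC (a + b * k).
  rewrite !trace_hsdot // raddfD /= !mxtraceZ tphi tomega !mulr1.
  by rewrite rCD rCM.
have [||dtau ttau] := measure_prepare_trans pA pB pphi pW.
- move=> s Fs; have [ps _] := free_density freeF Fs.
  by rewrite !trace_hsdot //; exact: free.
- by rewrite trY -rC0 ltr_rC.
eexists; split; [exact: dtau | exact: ttau |].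
rewrite trY !trace_hsdot // -/a -/b -rCV hsdotZr hsdotDr !hsdotZr.
have -> : hsdot phi phi = 1 by rewrite /hsdot pure_idem // tphi.
by apply: overlap_arith => //; apply: hsdot_psd_ge0.
Qed.

(** States have bounded entries, so near-optimal ones cluster. Reachability is itself a closure, and
    the fidelity with [phi] is linear, so both persist in the limit. *)
Lemma overlap_attained (e : R) :
  (forall d, 0 < d -> exists tau, [/\ density tau, prob_trans F F' rho tau &
                                      e - d <= hsdot phi tau]) ->
  exists tau, [/\ density tau, prob_trans F F' rho tau &
                  rC e <= fidelity tau phi].
Proof.
move=> h.
pose P d := [set tau | [/\ density tau, prob_trans F F' rho tau &
                           e - d <= hsdot phi tau]].
have [] := @matrix_cluster R m P 1.
- move=> d d' dd' X [? ? hX]; split=> //; apply: le_trans hX.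
  by rewrite lerD2l lerN2.
- by move=> d /h[tau ?]; exists tau.
- by move=> d X _ [dX _ _] i j; rewrite rC1; apply: density_entry_le.
move=> X hX.
have dX : density X by apply: (density_closure (hX 1 ltr01)) => Y [].
exists X; split=> //.
  apply: in_closure_idem; apply: in_closure_sub (hX 1 ltr01).
  by move=> Y [].
rewrite fidelity_pure // trace_hsdot ?ler_rC; first last.
- by case: dX.
- by case: pure_phi => -[].
apply/ler_addgt0Pr => d d0.
suff : 0 <= (d - e) + hsdot phi X by lra.
by apply: (closure_Re_ge0 (hX d d0)) => Y [_ _]; rewrite -/(hsdot phi Y); lra.
Qed.

(** [L] holds feasible values approaching [Rr] from above, and [g] stays strictly below [Om]; since
    neither bound need be attained, the overlap is first reached up to [d]. *)
Lemma achievable_threshold (L : set R) (Om Rr : \bar R) :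
  (1%:E <= Om)%E -> (1%:E <= Rr)%E -> (forall l, L l -> 1 < l) ->
  (forall x : R, (Rr < x%:E)%E -> exists2 l, L l & l < x) ->
  (forall g l, 0 < g -> (g%:E < Om)%E -> L l ->
     exists tau, [/\ density tau, prob_trans F F' rho tau &
                     g / (g + (l - 1)) <= hsdot phi tau]) ->
  forall eps : R, (threshold Om Rr <= eps%:E)%E ->
  exists tau, [/\ density tau, prob_trans F F' rho tau &
                  rC (1 - eps) <= fidelity tau phi].
Proof.
move=> Om1 Rr1 L1 Ladh ach eps.
case: Rr Rr1 Ladh => [r| |] //; last first.
  (* For [Rr = +oo] the threshold is [1], so any reachable state works. *)
  move=> _ _; rewrite /threshold addye //= mule0 add0e /= oner_eq0 invr1 lee_fin.
  move=> eps1; have [tau [dtau ttau]] := trans_exists.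
  exists tau; split=> //; apply: le_trans (fidelity_ge0 _ _).
  by rewrite -rC0 ler_rC subr_le0.
rewrite lee_fin => r1 Ladh thr; apply: overlap_attained => d d0.
suff [g [l [g0 gOm Ll hgl]]] : exists g l, [/\ 0 < g, (g%:E < Om)%E, L l &
    1 - eps - d <= g / (g + (l - 1))].
  have [tau [? ? h]] := ach g l g0 gOm Ll; exists tau; split=> //.
  exact: le_trans h.
have close x : 0 < x -> exists2 l, L l & l < r + x.
  by move=> x0; apply: Ladh; rewrite lte_fin ltrDl.
(* For thresholds equal to [0]: [u <= x * g] gives overlap at least [1 / (1 + x)], which is at least
   [1 - d]. *)
have far (g u x : R) : 0 < g -> 0 < u -> u <= x * g -> 0 <= eps -> x <= d ->
    1 - eps - d <= g / (g + u).
  move=> g0 u0 uxg e0 xd; rewrite ler_pdivlMr ?addr_gt0 //.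
  by have := addr_gt0 g0 u0; nra.
move: thr; rewrite /threshold.
have -> : (r%:E - 1%:E = (r - 1)%:E)%E by [].
rewrite /= subr_eq0; case: eqVneq => [rE|rN1].
  (* For [Rr = 1] the inverse of [0] is [+oo]. The value [g = 1/2] is below [Om], and
     [l - 1 < d / 2] suffices. *)
  rewrite gt0_muley ?(lt_le_trans _ Om1) ?lte_fin // addye //= lee_fin => e0.
  have [|l Ll hl] := close (d / 2); first by rewrite divr_gt0.
  exists 2^-1, l; split=> //.
    by apply: lt_le_trans Om1; rewrite lte_fin invf_lt1 // ltr1n.
  apply: (far _ _ d) => //; last by lra.
  by have := L1 _ Ll; rewrite subr_gt0.
have u0 : 0 < r - 1 by rewrite subr_gt0 lt_neqAle eq_sym rN1.
case: Om Om1 ach => [w| |] // Om1 _; last first.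
  (* For [Om = +oo] every [g] is allowed; the choice below makes [(l - 1) / g] equal to [d]. *)
  rewrite gt0_mulye ?lte_fin ?invr_gt0 // addye //= lee_fin => e0.
  have [l Ll hl] := close 1 ltr01.
  have l0 : 0 < l - 1 by rewrite subr_gt0 L1.
  exists ((l - 1) / d), l; split=> //; first by rewrite divr_gt0.
    exact: ltry.
  apply: (far _ _ d) => //; first by rewrite divr_gt0.
  by rewrite mulrC divfK // gt_eqF.
rewrite -EFinM -EFinD /=; rewrite lee_fin in Om1.
have wr0 : 0 < w / (r - 1) + 1 by rewrite ltr_wpDl // divr_ge0 ?ltW //; lra.
rewrite gt_eqF // lee_fin => thr.
(* Lowering [g] and raising [l] by at most [eta] does not enlarge the denominator beyond
   [w + (r - 1) >= 1], so at most [eta <= d] is lost; [2^-1] keeps [w - eta] positive. *)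
pose eta := Num.min d 2^-1.
have eta0 : 0 < eta by rewrite lt_min d0 /= invr_gt0.
have etad : eta <= d by rewrite ge_min lexx.
have eta2 : eta <= 2^-1 by rewrite ge_min lexx orbT.
have [l Ll hl] := close eta eta0; have l1 := L1 _ Ll.
exists (w - eta), l; split=> //; [lra | by rewrite lte_fin; lra |].
have thrE : (w / (r - 1) + 1)^-1 = 1 - w / (w + (r - 1)).
  by field; apply/andP; split; rewrite gt_eqF //; lra.
rewrite thrE in thr.
apply: le_trans (_ : (w - eta) / (w + (r - 1)) <= _); last first.
  by rewrite ler_pM2l ?lef_pV2 ?posrE; lra.
have : eta / (w + (r - 1)) <= eta by rewrite ler_pdivrMr; nra.
rewrite mulrBl; lra.
Qed.

Hypothesis phi_not_free : ~ F' phi.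

(** By traces, the weight of the cone element is [l - 1]; if it vanished, [phi] would equal the free
    [s]. *)
Lemma le_cone_gt1 (l : R) s : F' s -> le_cone F' phi (rC l *: s) -> 1 < l.
Proof.
move=> Fs [k k0 [t Ft e]].
have ts := proj2 (free_density freeF' Fs); have tt := proj2 (free_density freeF' Ft).
have tphi := proj2 (proj1 pure_phi).
have kE : l - 1 = k.
  have := congr1 mxtrace e; rewrite raddfB /= !mxtraceZ ts tt tphi !mulr1.
  by rewrite -rC1 -rCN -rCD => -[].
rewrite -subr_gt0 kE lt_neqAle k0 andbT; apply/eqP => k00; apply: phi_not_free.
have -> : phi = s; last by [].
move: e; rewrite -k00 rC0 scale0r => /eqP; rewrite subr_eq0 => /eqP <-.
have l1 : l = 1 by lra.
by rewrite l1 rC1 scale1r.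
Qed.

(** At [l = 1] the difference [s - phi] would be positive and traceless, hence zero. *)
Lemma loewner_gt1 (l : R) s : F' s -> loewner phi (rC l *: s) -> 1 < l.
Proof.
move=> Fs h; have [dphi _] := pure_phi; have ds := free_density freeF' Fs.
rewrite lt_neqAle (density_le_scale dphi ds h) andbT; apply/eqP => l1.
apply: phi_not_free; suff -> : phi = s by [].
apply/esym/eqP; rewrite -subr_eq0; apply/eqP; apply: psd_trace0.
  by move: h; rewrite /loewner -l1 rC1 scale1r.
by rewrite raddfB /= (proj2 ds) (proj2 dphi) subrr.
Qed.

Lemma convex_achievable (eps : R) :
  (threshold (OmegaF F rho) (RFF F' phi) <= eps%:E)%E ->
  exists tau, [/\ density tau, prob_trans F F' rho tau &
                  rC (1 - eps) <= fidelity tau phi].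
Proof.
pose L := [set l : R | exists2 s, F' s & le_cone F' phi (rC l *: s)].
have L1 l : L l -> 1 < l by move=> [s Fs]; apply: le_cone_gt1.
apply: (@achievable_threshold L) => //.
- exact: OmegaF_ge1.
- apply: le_ereal_inf_tmp => _ [s Fs <-]; apply: le_ereal_inf_tmp => _ [l h <-].
  by rewrite lee_fin ltW // L1 //; exists s.
- move=> x /ereal_inf_lt[_ [s Fs <-]] /ereal_inf_lt[_ [l h <-]].
  by rewrite lte_fin => lx; exists l => //; exists s.
move=> g l g0 gOm [s Fs lec]; have l1 := le_cone_gt1 Fs lec.
have [A [B [pA pB hAB hrho]]] := OmegaF_dual freeF drho gOm.
case: lec => k k0 [t Ft e].
have kE : l - 1 = k.
  have := congr1 mxtrace e; rewrite raddfB /= !mxtraceZ.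
  rewrite (proj2 (free_density freeF' Fs)) (proj2 (free_density freeF' Ft)).
  by rewrite (proj2 (proj1 pure_phi)) !mulr1 -rC1 -rCN -rCD => -[].
rewrite kE; apply: (achievable_overlap pA pB (free_density freeF' Ft)) => //.
  by rewrite -kE subr_gt0.
move=> r Fr; have [pr _] := free_density freeF Fr.
have a0 := hsdot_psd_ge0 pA pr; have ab := hAB _ Fr.
(* Substituting [phi = l s - k t] leaves only free states, and [ab] makes the coefficient of [t]
   nonnegative. *)
have -> : rC (hsdot A r) *: phi + rC (hsdot B r) *: (rC k *: t) =
    rC (hsdot A r * l) *: s + rC ((hsdot B r - hsdot A r) * k) *: t.
  have -> : phi = rC l *: s - rC k *: t by rewrite -e subKr.
  rewrite !rCM rCD rCN; apply/matrixP => i j; rewrite !mxE; ring.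
apply: coneD => //.
  exists (hsdot A r * l); last by exists s.
  by rewrite mulr_ge0 // ltW // (lt_trans ltr01).
exists ((hsdot B r - hsdot A r) * k); last by exists t.
by rewrite mulr_ge0 // subr_ge0.
Qed.

Lemma affine_achievable (eps : R) : affine_set F ->
  (threshold (OmegaF F rho) (RF F' phi) <= eps%:E)%E ->
  exists tau, [/\ density tau, prob_trans F F' rho tau &
                  rC (1 - eps) <= fidelity tau phi].
Proof.
move=> affF.
pose L := [set l : R | exists2 s, F' s & loewner phi (rC l *: s)].
have L1 l : L l -> 1 < l by move=> [s Fs]; apply: loewner_gt1.
apply: (@achievable_threshold L) => //.
- exact: OmegaF_ge1.
- apply: le_ereal_inf_tmp => _ [s Fs <-]; apply: le_ereal_inf_tmp => _ [l h <-].
  by rewrite lee_fin ltW // L1 //; exists s.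
- move=> x /ereal_inf_lt[_ [s Fs <-]] /ereal_inf_lt[_ [l h <-]].
  by rewrite lte_fin => lx; exists l => //; exists s.
move=> g l g0 gOm [s Fs lec]; have l1 := loewner_gt1 Fs lec.
have [A [B [pA pB hAB hrho]]] := OmegaF_dual_affine freeF affF drho gOm.
have k0 : 0 < l - 1 by rewrite subr_gt0.
(* This state may fail to be free; with equal weights on [phi] and [(l - 1) t], every free input is
   sent to a multiple of [s]. *)
pose t := rC (l - 1)^-1 *: (rC l *: s - phi).
have tE : rC (l - 1) *: t = rC l *: s - phi.
  by rewrite scalerA -rCM mulfV ?gt_eqF // rC1 scale1r.
have dt : density t.
  split; first by apply: psdZ => //; rewrite rC_ge0 invr_ge0 ltW.
  rewrite mxtraceZ raddfB /= mxtraceZ (proj2 (free_density freeF' Fs)).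
  by rewrite (proj2 (proj1 pure_phi)) mulr1 -rC1 -rCN -rCD -rCM mulVf ?gt_eqF.
apply: (achievable_overlap pA pB dt) => // r Fr.
have [pr _] := free_density freeF Fr.
exists (hsdot A r * l).
  by rewrite mulr_ge0 ?hsdot_psd_ge0 // ltW // (lt_trans ltr01).
exists s => //; rewrite -hAB // tE -scalerDr subrKC rCM scalerA //.
Qed.
End Fixed.
End Achievability.

Theorem theorem6 (R : realType) (n m : nat)
  (F : set 'M[R[i]]_n) (F' : set 'M[R[i]]_m)
  (rho : 'M[R[i]]_n) (phi : 'M[R[i]]_m) :
  free_set F -> free_set F' -> density rho -> pure phi -> ~ F' phi ->
  (forall eps : R,
     (threshold (OmegaF F rho) (RFF F' phi) <= eps%:E)%E ->
     exists tau : 'M[R[i]]_m, [/\ density tau, prob_trans F F' rho tau &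
                                  rC (1 - eps) <= fidelity tau phi])
  /\
  (affine_set F -> affine_set F' ->
   forall eps : R,
     (threshold (OmegaF F rho) (RF F' phi) <= eps%:E)%E ->
     exists tau : 'M[R[i]]_m, [/\ density tau, prob_trans F F' rho tau &
                                  rC (1 - eps) <= fidelity tau phi]).
Proof.
move=> freeF freeF' drho pphi nfree; split=> [eps|affF _ eps].
  exact: convex_achievable.
exact: affine_achievable.
Qed.
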